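(* For every integer $n \geq 2$, we have $\mathtt{COMPUTABLE}(\mathbb{Z}^n) \setminus \mathtt{BAIRE}(\mathbb{Z}^n) \neq \varnothing$.
   Context: Let $\Gamma$ be a finitely generated group. A locally checkable labeling (LCL) problem on $\Gamma$ is a triple $\Pi = (W, \Lambda, \mathcal{A})$ where $W \subseteq \Gamma$ is a finite set, $\Lambda$ is a finite set (of labels, with the discrete topology), and $\mathcal{A} \subseteq \Lambda^W$ is a family of maps $W \to \Lambda$. Given an action of $\Gamma$ on a set $X$, a solution to $\Pi$ on $X$ (or a $\Pi$-labeling of $X$) is a function $f \colon X \to \Lambda$ such that for all $x \in X$, the map $W \to \Lambda$, $w \mapsto f(w \cdot x)$, is in $\mathcal{A}$. An action of $\Gamma$ on $X$ is free if $\gamma \cdot x \neq x$ for all $x \in X$ and all non-identity $\gamma \in \Gamma$. An action of $\Gamma$ on a computable set $X \subseteq \mathbb{N}$ is computable if for each $\gamma \in \Gamma$ the function $X \to X$, $x \mapsto \gamma \cdot x$, is computable. Classes of LCL problems $\Pi = (W,\Lambda,\mathcal{A})$ on $\Gamma$: - $\Pi \in \mathtt{BAIRE}(\Gamma)$ iff every free Borel action of $\Gamma$ on a Polish space $X$ has a Baire-measurable $\Pi$-labeling $f \colon X \to \Lambda$. - $\Pi \in \mathtt{COMPUTABLE}(\Gamma)$ iff every free computable action of $\Gamma$ on a computable set $X \subseteq \mathbb{N}$ has a computable $\Pi$-labeling $f \colon X \to \Lambda$. *)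

(* Defs.v *)
From HB Require Import structures.
From mathcomp Require Import all_boot all_order all_algebra finmap.
From mathcomp Require Import all_classical all_reals.
From mathcomp Require Import topology measurable_structure.

Set Implicit Arguments.
Unset Strict Implicit.
Unset Printing Implicit Defensive.

Import Order.TTheory GRing.Theory Num.Theory.

Local Open Scope classical_set_scope.

Section Actions.
Variables (G : groupType) (X : Type).
Implicit Types act : G -> X -> X.

Definition is_action act :=
  (forall x, act 1%g x = x) /\
  (forall g h x, act (g * h)%g x = act g (act h x)).

Definition free_action act :=
  is_action act /\ (forall g x, g <> 1%g -> act g x <> x).

End Actions.

Record LCL (G : groupType) := mkLCL {
  lcl_window : {fset G};
  lcl_label : finType;
  lcl_allowed : {set {ffun lcl_window -> lcl_label}}
}.

Definition lcl_solution (G : groupType) (P : LCL G) (X : Type)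
    (act : G -> X -> X) (f : X -> lcl_label P) :=
  forall x : X,
    [ffun w : lcl_window P => f (act (val w) x)] \in lcl_allowed P.

Section Metrizability.
Variables (R : realType) (X : topologicalType).
Local Open Scope ring_scope.

Definition is_metric (d : X -> X -> R) :=
  [/\ forall x y, 0 <= d x y,
      forall x y, d x y = 0 <-> x = y,
      forall x y, d x y = d y x &
      forall x y z, d x z <= d x y + d y z].

Definition metric_compatible (d : X -> X -> R) :=
  forall x : X, nbhs x = filter_from [set e : R | 0 < e]
                                     (fun e => [set y | d x y < e]).

Definition metric_complete (d : X -> X -> R) :=
  forall u : nat -> X,
    (forall e : R, 0 < e ->
       exists N, forall m n, (N <= m)%N -> (N <= n)%N -> d (u m) (u n) < e) ->
    exists l : X, u @ \oo --> l.

Definition polish :=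
  (exists D : set X, countable D /\ dense D) /\
  (exists d : X -> X -> R,
     [/\ is_metric d, metric_compatible d & metric_complete d]).

End Metrizability.

Section BaireProperty.
Variable X : topologicalType.

Definition borel : set (set X) := <<s @open X >>.

Definition borel_fun (Y : topologicalType) (f : Y -> X) :=
  forall B : set X, borel B -> (<<s @open Y >>) (f @^-1` B).

Definition nowhere_dense (A : set X) := interior (closure A) = set0.

Definition meager (A : set X) :=
  exists2 F : nat -> set X,
    (forall i, nowhere_dense (F i)) & A = \bigcup_i F i.

Definition baire_property (A : set X) :=
  exists2 U : set X, open U & meager (A `+` U).

(* The codomain is discrete, so all of its subsets are open. *)
Definition baire_measurable (L : finType) (f : X -> L) :=
  forall S : set L, baire_property (f @^-1` S).

End BaireProperty.

(* As [G] is countable and discrete, [G * X -> X] is Borel iff each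
   [x |-> g x] is. *)
Definition borel_action (G : groupType) (X : topologicalType)
    (act : G -> X -> X) :=
  forall g : G, borel_fun (act g).

(* [BAIRE] and [COMPUTABLE] are classes of LCL problems; they are predicates
   rather than [set (LCL G)] because [LCL G] is too large a type for [set]. *)
Definition BAIRE (R : realType) (G : groupType) (P : LCL G) : Prop :=
  forall (X : topologicalType) (act : G -> X -> X),
     polish R X -> free_action act -> borel_action act ->
     exists f : X -> lcl_label P, baire_measurable f /\ lcl_solution act f.

Inductive recfun : nat -> Type :=
| RZero : recfun 0
| RSucc : recfun 1
| RProj n : 'I_n -> recfun n
| RComp m n : recfun m -> ('I_m -> recfun n) -> recfun n
| RPrec n : recfun n -> recfun n.+2 -> recfun n.+1
| RMin n : recfun n.+1 -> recfun n.

(* [recfun_eval c v y]: the partial function coded by [c] is defined at [v],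
   with value [y]. In [RPrec f g] the first argument is the recursion variable:
   h(0, v) = f(v) and h(k + 1, v) = g(k, h(k, v), v); in the clause below [s k]
   is h(k, v). [RMin f] maps [v] to the least [k] with f(k, v) = 0, provided
   f(i, v) is defined for all i < k. *)
Fixpoint recfun_eval n (c : recfun n) : n.-tuple nat -> nat -> Prop :=
  match c in recfun n return n.-tuple nat -> nat -> Prop with
  | RZero => fun _ y => y = 0
  | RSucc => fun v y => y = (thead v).+1
  | RProj _ i => fun v y => y = tnth v i
  | RComp m _ f g => fun v y =>
      exists2 w : m.-tuple nat,
        (forall i, recfun_eval (g i) v (tnth w i)) & recfun_eval f w y
  | RPrec _ f g => fun v y =>
      exists s : nat -> nat,
        [/\ recfun_eval f [tuple of behead v] (s 0),
            forall k, k < thead v ->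
              recfun_eval g [tuple of k :: s k :: behead v] (s k.+1) &
            y = s (thead v)]
  | RMin _ f => fun v y =>
      recfun_eval f [tuple of y :: v] 0 /\
      (forall i, i < y -> exists r, recfun_eval f [tuple of i :: v] r.+1)
  end.

Definition computable_set (X : set nat) :=
  exists c : recfun 1,
    forall x : nat, recfun_eval c [tuple x] (x \in X : bool).

(* The program may behave arbitrarily outside [X]. *)
Definition computable_on (X : set nat) (f : X -> nat) :=
  exists c : recfun 1, forall x : X, recfun_eval c [tuple val x] (f x).

Definition computable_action (G : groupType) (X : set nat)
    (act : G -> X -> X) :=
  forall g : G, computable_on (fun x => val (act g x)).

(* Labels are coded by their rank in the enumeration of [L]; the choice of
   coding is immaterial since [L] is finite. *)
Definition computable_labeling (X : set nat) (L : finType) (f : X -> L) :=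
  computable_on (fun x => enum_rank (f x) : nat).

Definition COMPUTABLE (G : groupType) (P : LCL G) : Prop :=
  forall (X : set nat) (act : G -> X -> X),
     computable_set X -> free_action act -> computable_action act ->
     exists f : X -> lcl_label P,
       computable_labeling f /\ lcl_solution act f.

Definition Zpow (n : nat) : groupType := Algebra.to_multiplicative 'rV[int]_n.

(* Main.v *)
From HB Require Import structures.
Require Import Defs.
From mathcomp Require Import all_boot all_order all_algebra finmap.
From mathcomp Require Import all_classical all_reals.
From mathcomp Require Import topology measurable_structure.
From mathcomp Require Import zify.

(** Only two generators e1, e2 matter. A label consists of a bounded integer flow
through a cell and of a colour; the flow has no sinks, and a point may have the
same colour as its e1-neighbour only if it is a source of the flow.

Not BAIRE: let Z^n translate the 3-adic odometer. By the Baire category theorem,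
a Baire measurable labelling has a point along whose orbit every pattern recurs
with period 3^k for some k. As 3^k is odd, the colours cannot alternate all along
an e1-line, so there is a source, and then sources have positive density. But the
flow out of an N x N square is O(N).

COMPUTABLE: the points 0, 1, 2, ... are treated in turn. If k is not yet labelled,
search for a square around it, so large that each square labelled earlier either
lies deep inside it or is far away, and label it compatibly with what has been
done before. The squares inside it are few and far apart, so there is room to let
each of them emit two units of flow per row and to lead these units, around the
other squares, to the outside along pairwise distinct rows; the sources on the
east sides of the squares allow to adjust the colours. *)

(** The labels are fixed in advance while the squares nest to arbitrary depth, so flow must not
    accumulate from level to level. Each square therefore keeps an interface that does not depend on
    its content: at most one unit leaves each row to the east, and nothing enters from the south or
    leaves to the north. The colours along a square are dictated by its old labels, and repairing
    the colouring next to it costs a second unit per row. Restoring the interface for a larger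
    square, in which these units need a row each, is the routing problem; the margins, growing with
    the index of the stage, provide the rows.

    Whether two points lie in one orbit need not be decidable, so the strategy never asks. It
    searches for a certificate, a square with a table of labels, all of whose conditions are
    decidable. Orbits enter only the proof that a certificate exists: a large square contains the
    earlier squares of its own orbit and cannot meet those of other orbits. *)

Set Implicit Arguments.
Unset Strict Implicit.
Unset Printing Implicit Defensive.

(** * Computable functions *)

(* The last component of a context is the first argument of a program. *)
Fixpoint ctx (n : nat) : Type := if n is m.+1 then (ctx m * nat)%type else unit.

Fixpoint tup n : ctx n -> n.-tuple nat :=
  match n return ctx n -> n.-tuple nat with
  | 0 => fun _ => [tuple]
  | m.+1 => fun g => [tuple of g.2 :: tup g.1]
  end.

Definition computable n (F : ctx n -> nat) :=
  exists c : recfun n, forall g, recfun_eval c (tup g) (F g).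

Fixpoint computable_ctx n m : (ctx n -> ctx m) -> Prop :=
  match m return (ctx n -> ctx m) -> Prop with
  | 0 => fun _ => True
  | m.+1 => fun G => computable_ctx (fun g => (G g).1) /\ computable (fun g => (G g).2)
  end.

Lemma behead_cons n x (t : n.-tuple nat) :
  [tuple of behead [tuple of x :: t]] = t.
Proof. exact: val_inj. Qed.

Lemma eq_computable n (F G : ctx n -> nat) : F =1 G -> computable F -> computable G.
Proof. by move=> FG [c cP]; exists c => g; rewrite -FG. Qed.

Lemma computable_proj n (i : 'I_n) : computable (fun g : ctx n => tnth (tup g) i).
Proof. by exists (RProj i). Qed.

Lemma computable_comp n m (F : ctx m -> nat) (G : ctx n -> ctx m) :
  computable F -> computable_ctx G -> computable (fun g => F (G g)).
Proof.
move=> [c cP] hG.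
have [cs csP] : exists cs : 'I_m -> recfun n,
    forall i g, recfun_eval (cs i) (tup g) (tnth (tup (G g)) i).
  (* For [m = 0] the family of programs is empty, and any program of arity [n] can serve as its
     default value. *)
  elim: m G hG {F c cP} => [|m IH] G /= hG; first by exists (fun=> RMin (RProj ord0)); case.
  case: hG => /IH [cs csP] [c cP].
  exists (fun i => if unlift ord0 i is Some j then cs j else c) => i g.
  case: unliftP => [j ->|->]; last by rewrite tnth0.
  by rewrite tnthS.
exists (RComp c cs) => g /=.
by exists (tup (G g)) => // i; apply: csP.
Qed.

Lemma computable_weak n (F : ctx n -> nat) : computable F -> computable (fun g : ctx n.+1 => F g.1).
Proof.
move=> [c cP].
exists (RComp c (fun i => RProj (lift ord0 i))) => g /=.
by exists (tup g.1) => // i /=; rewrite tnthS.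
Qed.

Lemma computable_var0 n : computable (fun g : ctx n.+1 => g.2).
Proof. by apply: eq_computable (computable_proj ord0) => g; rewrite tnth0. Qed.

Lemma computable_var1 n : computable (fun g : ctx n.+2 => g.1.2).
Proof. exact: computable_weak (computable_var0 n). Qed.

Lemma computable_var2 n : computable (fun g : ctx n.+3 => g.1.1.2).
Proof. exact: computable_weak (computable_var1 n). Qed.

Lemma computable_var3 n : computable (fun g : ctx n.+4 => g.1.1.1.2).
Proof. exact: computable_weak (computable_var2 n). Qed.

Lemma computable_var4 n : computable (fun g : ctx n.+4.+1 => g.1.1.1.1.2).
Proof. exact: computable_weak (computable_var3 n). Qed.

Lemma computable_var5 n : computable (fun g : ctx n.+4.+2 => g.1.1.1.1.1.2).
Proof. exact: computable_weak (computable_var4 n). Qed.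

Lemma computable_ctx_id n : computable_ctx (fun g : ctx n => g).
Proof.
suff H k m (G : ctx m -> ctx k) : computable_ctx G -> computable_ctx (fun g : ctx m.+1 => G g.1).
  by elim: n => //= n IH; split; [apply: H IH | apply: computable_var0].
elim: k G => //= k IH G [h1 h2]; split; first exact: IH h1.
exact: computable_weak h2.
Qed.

Lemma computable_const n k : computable (fun _ : ctx n => k).
Proof.
have c0 : computable (fun _ : ctx 0 => 0) by exists RZero.
have cS : computable (fun g : ctx 1 => g.2.+1) by exists RSucc => g /=; rewrite /thead tnth0.
elim: k => [|k IH]; first by apply: (@computable_comp n 0 _ (fun=> tt) c0).
by apply: (@computable_comp n 1 _ (fun=> (tt, k)) cS).
Qed.

Ltac computable_var :=
  match goal with
  | |- @computable ?m.+1 _ => exact (computable_var0 m)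
  | |- @computable ?m.+2 _ => exact (computable_var1 m)
  | |- @computable ?m.+3 _ => exact (computable_var2 m)
  | |- @computable ?m.+4 _ => exact (computable_var3 m)
  | |- @computable ?m.+4.+1 _ => exact (computable_var4 m)
  | |- @computable ?m.+4.+2 _ => exact (computable_var5 m)
  end.

Section Compose.
Variable n : nat.
Implicit Types a b c : ctx n -> nat.

Lemma computable_app1 (f : nat -> nat) a :
  computable (fun g : ctx 1 => f g.2) -> computable a -> computable (fun g => f (a g)).
Proof. by move=> hf ha; apply: (@computable_comp n 1 _ (fun g => (tt, a g)) hf). Qed.

Lemma computable_app2 (f : nat -> nat -> nat) a b :
  computable (fun g : ctx 2 => f g.1.2 g.2) -> computable a -> computable b ->
  computable (fun g => f (a g) (b g)).
Proof.
by move=> hf ha hb; apply: (@computable_comp n 2 _ (fun g => (tt, a g, b g)) hf).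
Qed.

Lemma computable_app3 (f : nat -> nat -> nat -> nat) a b c :
  computable (fun g : ctx 3 => f g.1.1.2 g.1.2 g.2) ->
  computable a -> computable b -> computable c ->
  computable (fun g => f (a g) (b g) (c g)).
Proof.
by move=> hf ha hb hc; apply: (@computable_comp n 3 _ (fun g => (tt, a g, b g, c g)) hf).
Qed.

Lemma computable_app4 (f : nat -> nat -> nat -> nat -> nat) a b c d :
  computable (fun g : ctx 4 => f g.1.1.1.2 g.1.1.2 g.1.2 g.2) ->
  computable a -> computable b -> computable c -> computable d ->
  computable (fun g => f (a g) (b g) (c g) (d g)).
Proof.
move=> hf ha hb hc hd.
by apply: (@computable_comp n 4 _ (fun g => (tt, a g, b g, c g, d g)) hf).
Qed.

Lemma computable_S a : computable a -> computable (fun g => (a g).+1).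
Proof.
by apply: (@computable_app1 succn); exists RSucc => g /=; rewrite /thead tnth0.
Qed.

(** [RPrec] puts the recursion variable, then the previous value, in front of the other arguments;
    contexts being read backwards, the step finds them at [p.2] and [p.1.2]. *)
Lemma computable_iteri (s : ctx n -> nat -> nat -> nat) a b :
  computable a -> computable b -> computable (fun p : ctx n.+2 => s p.1.1 p.2 p.1.2) ->
  computable (fun g => iteri (b g) (s g) (a g)).
Proof.
move=> [ca haP] hb [cs hs].
suff H : computable (fun p : ctx n.+1 => iteri p.2 (s p.1) (a p.1)).
  apply: (@computable_comp n n.+1 _ (fun g => (g, b g)) H).
  by split => //=; apply: computable_ctx_id.
exists (RPrec ca cs) => g /=; exists (fun k => iteri k (s g.1) (a g.1)).
split=> [|k _|]; [by rewrite behead_cons| |by rewrite /thead tnth0].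
have := hs ((g.1, iteri k (s g.1) (a g.1)), k).
by congr (recfun_eval cs _ _); apply: val_inj.
Qed.

End Compose.

Lemma computable_add n (a b : ctx n -> nat) :
  computable a -> computable b -> computable (fun g => a g + b g).
Proof.
move=> ha hb; apply: (@eq_computable _ (fun g => iteri (b g) (fun _ h => h.+1) (a g))).
  by move=> g; elim: (b g) => [|k /= ->]; rewrite ?addn0 ?addnS.
by apply: computable_iteri => //; apply: computable_S; computable_var.
Qed.

Lemma computable_mul n (a b : ctx n -> nat) :
  computable a -> computable b -> computable (fun g => a g * b g).
Proof.
move=> ha hb; apply: (@eq_computable _ (fun g => iteri (b g) (fun _ h => h + a g) 0)).
  by move=> g; elim: (b g) => [|k /= ->]; rewrite ?muln0 // mulnS addnC.
apply: computable_iteri => //; first exact: computable_const.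
by apply: computable_add; [computable_var|exact: computable_weak (computable_weak ha)].
Qed.

Lemma computable_pred n (a : ctx n -> nat) :
  computable a -> computable (fun g => (a g).-1).
Proof.
move=> ha; apply: (@eq_computable _ (fun g => iteri (a g) (fun i _ => i) 0)).
  by move=> g; case: (a g).
by apply: computable_iteri => //; [apply: computable_const|computable_var].
Qed.

(** * Decidable predicates, as functions with values 0 and 1 *)

Definition computableb n (P : ctx n -> bool) := computable (fun g => nat_of_bool (P g)).

Section Truncated.
Variable n : nat.
Implicit Types a b c : ctx n -> nat.
Implicit Types P Q : ctx n -> bool.

Lemma computable_sub a b :
  computable a -> computable b -> computable (fun g => a g - b g).
Proof.
move=> ha hb; apply: (@eq_computable _ (fun g => iteri (b g) (fun _ h => h.-1) (a g))).
  by move=> g; elim: (b g) => [|k /= ->]; rewrite ?subn0 // subnS.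
by apply: computable_iteri => //; apply: computable_pred; computable_var.
Qed.

Lemma computable_exp a b :
  computable a -> computable b -> computable (fun g => a g ^ b g).
Proof.
move=> ha hb; apply: (@eq_computable _ (fun g => iteri (b g) (fun _ h => h * a g) 1)).
  by move=> g; elim: (b g) => //= k ->; rewrite expnSr.
apply: computable_iteri => //; first exact: computable_const.
by apply: computable_mul; [computable_var|exact: computable_weak (computable_weak ha)].
Qed.

Lemma computableb_neg P : computableb P -> computableb (fun g => ~~ P g).
Proof.
move=> hP; apply: (@eq_computable _ (fun g => 1 - P g)); first by move=> g; case: (P g).
by apply: computable_sub => //; apply: computable_const.
Qed.

Lemma computableb_and P Q : computableb P -> computableb Q -> computableb (fun g => P g && Q g).
Proof.
move=> hP hQ; apply: (@eq_computable _ (fun g => P g * Q g)); last exact: computable_mul.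
by move=> g; rewrite mulnb.
Qed.

Lemma computable_if P a b : computableb P -> computable a -> computable b ->
  computable (fun g => if P g then a g else b g).
Proof.
move=> hP ha hb; apply: (@eq_computable _ (fun g => P g * a g + ~~ P g * b g)).
  by move=> g; case: (P g); rewrite /= ?mul1n ?mul0n ?addn0.
by apply: computable_add; apply: computable_mul => //; apply: computableb_neg.
Qed.

Lemma computableb_leq a b :
  computable a -> computable b -> computableb (fun g => a g <= b g).
Proof.
move=> ha hb; apply: (@eq_computable _ (fun g => 1 - (a g - b g))).
  by move=> g; rewrite /leq; case: (a g - b g) => //= k; rewrite subSS sub0n.
by apply: computable_sub; [apply: computable_const|apply: computable_sub].
Qed.

End Truncated.

Section Boolean.
Variable n : nat.
Implicit Types a b c : ctx n -> nat.
Implicit Types P Q : ctx n -> bool.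

Lemma computableb_or P Q : computableb P -> computableb Q -> computableb (fun g => P g || Q g).
Proof.
move=> hP hQ; apply: (@eq_computable _ (fun g => ~~ (~~ P g && ~~ Q g))).
  by move=> g; rewrite negb_and !negbK.
by apply/computableb_neg/computableb_and; apply: computableb_neg.
Qed.

Lemma computableb_imp P Q : computableb P -> computableb Q -> computableb (fun g => P g ==> Q g).
Proof.
move=> hP hQ; apply: (@eq_computable _ (fun g => ~~ P g || Q g)).
  by move=> g; rewrite implybE.
by apply/computableb_or => //; apply: computableb_neg.
Qed.

Lemma computableb_eq a b :
  computable a -> computable b -> computableb (fun g => a g == b g).
Proof.
move=> ha hb; apply: (@eq_computable _ (fun g => (a g <= b g) && (b g <= a g))).
  by move=> g; rewrite -eqn_leq.
by apply: computableb_and; apply: computableb_leq.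
Qed.

Lemma computableb_eqb P Q : computableb P -> computableb Q -> computableb (fun g => P g == Q g).
Proof.
move=> hP hQ; apply: (@eq_computable _ (fun g => (P g : nat) == Q g)); last exact: computableb_eq.
by move=> g; case: (P g); case: (Q g).
Qed.

Lemma computableb_all (P : ctx n -> nat -> bool) b :
  computable b -> computableb (fun p : ctx n.+1 => P p.1 p.2) ->
  computableb (fun g => all (P g) (iota 0 (b g))).
Proof.
move=> hb hP.
apply: (@eq_computable _ (fun g => iteri (b g) (fun i h => h * P g i) 1)).
  move=> g; elim: (b g) => [//|k IH].
  by rewrite -addn1 iotaD all_cat /= andbT addn1 -mulnb -IH.
apply: computable_iteri => //; first exact: computable_const.
apply: computable_mul; first computable_var.
apply: (@computable_comp n.+2 n.+1 _ (fun p => (p.1.1, p.2)) hP); split => /=.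
  by have [[]] := computable_ctx_id n.+2.
computable_var.
Qed.

Lemma computableb_has (P : ctx n -> nat -> bool) b :
  computable b -> computableb (fun p : ctx n.+1 => P p.1 p.2) ->
  computableb (fun g => has (P g) (iota 0 (b g))).
Proof.
move=> hb hP.
apply: (@eq_computable _ (fun g => ~~ all (fun i => ~~ P g i) (iota 0 (b g)))).
  by move=> g; rewrite all_predC negbK.
by apply/computableb_neg/computableb_all => //; apply: computableb_neg.
Qed.

End Boolean.

(** * Routing the flow between squares *)

Section DoubleSum.
Variables (K : nat) (I : pred nat) (N : nat -> nat).
Implicit Type b : nat -> nat -> bool.

Definition sum2 b := \sum_(l < K | I l) \sum_(m < N l) b l m.

Lemma sum2_gt0P b :
  reflect (exists l m, [/\ l < K, I l, m < N l & b l m]) (0 < sum2 b).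
Proof.
rewrite lt0n sum_nat_eq0 negb_forall; apply: (iffP existsP) => [[l]|[l [m [lK Il mN blm]]]].
  rewrite negb_imply sum_nat_eq0 negb_forall => /andP[Il /existsP[m]].
  by rewrite eqb0 /= negbK => bm; exists l, m.
exists (Ordinal lK); rewrite negb_imply Il sum_nat_eq0 negb_forall.
by apply/existsP; exists (Ordinal mN); rewrite /= blm.
Qed.

Lemma sum2_ge1 b l m : l < K -> I l -> m < N l -> b l m -> 1 <= sum2 b.
Proof. by move=> *; apply/sum2_gt0P; exists l, m. Qed.

Lemma sum2_eq0 b : (forall l m, l < K -> I l -> m < N l -> b l m -> False) -> sum2 b = 0.
Proof.
move=> bF; apply/eqP; rewrite -leqn0 leqNgt; apply/negP => /sum2_gt0P.
by case=> l [m [? ? ?]]; apply: bF.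
Qed.

Lemma sum2_le1 b :
  (forall l m l' m', l < K -> I l -> m < N l -> l' < K -> I l' -> m' < N l' ->
    b l m -> b l' m' -> l = l' /\ m = m') -> sum2 b <= 1.
Proof.
move=> buniq; case: (posnP (sum2 b)) => [-> //|/sum2_gt0P[l [m [lK Il mN blm]]]].
rewrite /sum2 (bigD1 (Ordinal lK)) //= (bigD1 (Ordinal mN)) //= blm.
have -> : \sum_(m' < N l | m' != Ordinal mN) b l m' = 0.
  apply: big1 => m' m'm; apply/eqP; rewrite eqb0; apply: contraNN m'm => blm'.
  by apply/eqP/val_inj; have [] := buniq _ _ _ _ lK Il mN lK Il (ltn_ord m') blm blm'.
rewrite big1 // => l' /andP[Il' l'l].
apply: big1 => m' _; apply/eqP; rewrite eqb0; apply: contraNN l'l => blm'.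
apply/eqP/val_inj => /=.
by have [] := buniq _ _ _ _ lK Il mN (ltn_ord l') Il' (ltn_ord m') blm blm'.
Qed.

End DoubleSum.

(** * Pairwise distinct target rows *)

Section Target.
Implicit Types l v m : nat.

(* The 2-adic valuation of a target row is the index of the box which sends a
   ray to it, so different boxes never compete for a row. *)
Definition target l v m := 2 ^ l * (v %/ 2 ^ l.+1 + m).+1.*2.+1.

Lemma target_inj l v m l' v' m' :
  target l v m = target l' v' m' -> l = l' /\ (v = v' -> m = m').
Proof.
rewrite /target => E.
have lE : l = l'.
  have H k q : logn 2 (2 ^ k * q.*2.+1) = k.
    by rewrite lognM ?expn_gt0 // pfactorK // lognE dvdn2 /= odd_double /= addn0.
  by rewrite -(H l (v %/ 2 ^ l.+1 + m).+1) E H.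
split=> // vE; move: E; rewrite -lE -vE => /eqP.
by rewrite eqn_pmul2l ?expn_gt0 // => /eqP; lia.
Qed.

(** The target is [v] rounded down to a multiple of [2 ^ l.+1], plus [m.+1] steps of that length and
    the half step [2 ^ l]. One full step already exceeds the rounding error. *)
Lemma target_bounds l v m : v < target l v m <= v + 2 ^ l * (2 * m + 3).
Proof.
rewrite /target expnS.
have := divn_eq v (2 * 2 ^ l); have := @ltn_pmod v (2 * 2 ^ l).
set q := v %/ _; set r := v %% _; have : 0 < 2 ^ l by rewrite expn_gt0.
by set p := 2 ^ l => ? ? ?; nia.
Qed.

End Target.

Ltac bool_cases :=
  repeat match goal with
  | |- context [?x == ?y] => case: (@eqP _ x y) => ? /=; try (exfalso; lia)
  | |- context [?x <= ?y] => case: (leqP x y) => ? /=; try (exfalso; lia)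
  end; try lia.

(** Outflow against inflow at a cell, for a unit going east in row [r], north in column [c] and east
    again in row [t]. The last summand is its source, the cell just west of [s]. *)
Lemma path_conserved (s c r t x y : nat) : 0 < s -> s <= c -> r < t ->
  [&& y == r, s <= x.+1 & x.+1 <= c] + ((y == t) && (c < x.+1))
  + [&& x == c, r < y.+1 & y.+1 <= t] =
  [&& y == r, s <= x & x <= c] + ((y == t) && (c < x))
  + [&& x == c, r < y & y <= t] + ((y == r) && (x.+1 == s)).
Proof. move=> s0 sc rt. bool_cases. Qed.
(** A clockwise circulation has no source. Its westward and southward edges count negatively and are
    moved to the other side to stay in [nat]. *)
Lemma rect_conserved (x0 x1 y0 y1 x y : nat) : x0 < x1 -> y0 < y1 ->
  [&& y == y1, x0 < x.+1 & x.+1 <= x1] + [&& x == x0, y0 < y.+1 & y.+1 <= y1]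
  + [&& y == y0, x0 < x & x <= x1] + [&& x == x1, y0 < y & y <= y1] =
  [&& y == y1, x0 < x & x <= x1] + [&& x == x0, y0 < y & y <= y1]
  + [&& y == y0, x0 < x.+1 & x.+1 <= x1] + [&& x == x1, y0 < y.+1 & y.+1 <= y1].
Proof. move=> h1 h2. bool_cases. Qed.

Section Routing.

Variables (K L : nat) (I : pred nat) (a u n : nat -> nat).

(** Rows of 2-adic valuation [l] are [2 ^ l.+1] apart, so the [2 * s] target rows of a box of side
    [s] stretch over about [2 ^ l * (4 * s)] rows above it; the rest absorbs the rounding in
    [target]. The same width has room for the private columns to the east and for the bypasses. *)
Definition margin l s := 2 ^ l * (4 * s + 8).

Let mg l := margin l (n l).

Definition infl l x y :=
  [&& a l <= x + mg l, x < a l + n l + mg l,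
      u l <= y + mg l & y < u l + n l + mg l].
Definition inb l x y :=
  [&& a l <= x, x < a l + n l, u l <= y & y < u l + n l].

Hypothesis fit : forall l, l < K -> I l ->
  [/\ mg l <= a l, mg l <= u l, a l + n l + mg l <= L & u l + n l + mg l <= L].
Hypothesis disj : forall l l' x y, l < K -> I l -> l' < K -> I l' ->
  infl l x y -> infl l' x y -> l = l'.

Let col l m := a l + n l + m.+1.
Let row l m := u l + m./2.
Let tgt l m := target l (u l + n l) m.
Let N l := (n l).*2.

Let mg_ge l : 4 * n l + 8 <= mg l.
Proof. by rewrite /mg /margin leq_pmull ?expn_gt0. Qed.

Let tgt_bounds l m : m < N l -> u l + n l < tgt l m < u l + n l + mg l.
Proof.
move=> mN; have /andP[-> /= h] := target_bounds l (u l + n l) m.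
apply: leq_ltn_trans h _; rewrite ltn_add2l /mg /margin ltn_pmul2l ?expn_gt0 //.
by rewrite /N in mN; lia.
Qed.

(* Box [l] emits two units of flow per row: one leaves the box itself, the other
   is created at the cell to its right, which may then carry a defect. Unit [m]
   goes east along [row l m], north along the private column [col l m], and
   finally east along [tgt l m] forever. If such a final row crosses another
   box, in its row number [j], the ray bypasses that box: one adds the circulation
   around the rectangle with columns [lft l j], [rgt l j] and rows [u l + j],
   [u l + n l + j] ([l] being that box), whose negative parts are [wneg] and [sneg]. *)
Let start l m := a l + n l + odd m.
Let lft l j := a l - j.+1.
Let rgt l j := a l + n l + j.+1.

Let pre x y l m := [&& y == row l m, start l m <= x & x <= col l m].
Let post x y l m := (y == tgt l m) && (col l m < x).
Let vert x y l m := [&& x == col l m, row l m < y & y <= tgt l m].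
Let src x y l m := (y == row l m) && (x.+1 == start l m).

Let R x y := sum2 K I N (post x y).
Let pass l j := 0 < R (a l) (u l + j).

Let wneg x y l j := pass l j && [&& y == u l + j, lft l j < x & x <= rgt l j].
Let wpos x y l j := pass l j && [&& y == u l + n l + j, lft l j < x & x <= rgt l j].
Let spos x y l j := pass l j && [&& x == lft l j, u l + j < y & y <= u l + n l + j].
Let sneg x y l j := pass l j && [&& x == rgt l j, u l + j < y & y <= u l + n l + j].

Let s2 := sum2 K I N.
Let s1 := sum2 K I n.
Let Wp x y := s2 (pre x y) + R x y + s1 (wpos x y).
Let Wn x y := s1 (wneg x y).
Let Sp x y := s2 (vert x y) + s1 (spos x y).
Let Sn x y := s1 (sneg x y).

Let flow_conserved x y :
  Wp x.+1 y + Sp x y.+1 + Wn x y + Sn x y =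
  Wp x y + Sp x y + Wn x.+1 y + Sn x y.+1 + s2 (src x y).
Proof.
rewrite /Wp /Wn /Sp /Sn.
have E1 : s2 (pre x.+1 y) + R x.+1 y + s2 (vert x y.+1)
   = s2 (pre x y) + R x y + s2 (vert x y) + s2 (src x y).
  rewrite /s2 /R /sum2 -!big_split /=; apply: eq_bigr => l Il.
  rewrite -!big_split /=; apply: eq_bigr => m _.
  have := tgt_bounds (ltn_ord m).
  have : m./2 < n l by have := ltn_ord m; rewrite /N; lia.
  have [fa _ _ _] := fit (ltn_ord l) Il; have := mg_ge l.
  move=> *; apply: path_conserved; rewrite /start /col /row; lia.
have E2 : s1 (wpos x.+1 y) + s1 (spos x y.+1) + s1 (wneg x y) + s1 (sneg x y)
   = s1 (wpos x y) + s1 (spos x y) + s1 (wneg x.+1 y) + s1 (sneg x y.+1).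
  rewrite /s1 /sum2 -!big_split /=; apply: eq_bigr => l Il.
  rewrite -!big_split /=; apply: eq_bigr => j _.
  have [fa _ _ _] := fit (ltn_ord l) Il; have := mg_ge l; have := ltn_ord j.
  rewrite /wpos /wneg /spos /sneg; case: (pass l j) => //= *.
  by apply: rect_conserved; rewrite /lft /rgt; lia.
lia.
Qed.

Let loc_le1 Nf (b : nat -> nat -> bool) x y :
  (forall l m, l < K -> I l -> m < Nf l -> b l m -> infl l x y) ->
  (forall l m m', b l m -> b l m' -> m = m') -> sum2 K I Nf b <= 1.
Proof.
move=> binfl binj; apply: sum2_le1 => l m l' m' lK Il mN lK' Il' mN' h h'.
have ll' := disj lK Il lK' Il' (binfl _ _ lK Il mN h) (binfl _ _ lK' Il' mN' h').
by rewrite -{}ll' in h' *; split=> //; apply: binj h h'.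
Qed.

Let pre_infl x y l m : l < K -> I l -> m < N l -> pre x y l m -> infl l x y.
Proof.
move=> lK Il; rewrite /N => mN /and3P[/eqP ->].
have := mg_ge l; have [] := fit lK Il.
by rewrite /infl /row /start /col => *; apply/and4P; split; lia.
Qed.

Let vert_infl x y l m : l < K -> I l -> m < N l -> vert x y l m -> infl l x y.
Proof.
move=> lK Il mN /and3P[/eqP ->].
have := mg_ge l; have [] := fit lK Il; have := tgt_bounds mN; move: mN.
by rewrite /N /infl /row /start /col => *; apply/and4P; split; lia.
Qed.

Let turn_infl l m : l < K -> I l -> m < N l -> infl l (col l m) (tgt l m).
Proof.
move=> lK Il mN; apply: (vert_infl lK Il mN).
have := tgt_bounds mN; move: mN; rewrite /vert eqxx leqnn /= andbT /row /N; lia.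
Qed.

Let wneg_infl x y l j : l < K -> I l -> j < n l -> wneg x y l j -> infl l x y.
Proof.
move=> lK Il jn /and4P[_ /eqP ->]; have := mg_ge l; have [] := fit lK Il.
by rewrite /infl /lft /rgt => *; apply/and4P; split; lia.
Qed.

Let wpos_infl x y l j : l < K -> I l -> j < n l -> wpos x y l j -> infl l x y.
Proof.
move=> lK Il jn /and4P[_ /eqP ->]; have := mg_ge l; have [] := fit lK Il.
by rewrite /infl /lft /rgt => *; apply/and4P; split; lia.
Qed.

Let spos_infl x y l j : l < K -> I l -> j < n l -> spos x y l j -> infl l x y.
Proof.
move=> lK Il jn /and4P[_ /eqP ->]; have := mg_ge l; have [] := fit lK Il.
by rewrite /infl /lft /rgt => *; apply/and4P; split; lia.
Qed.

Let sneg_infl x y l j : l < K -> I l -> j < n l -> sneg x y l j -> infl l x y.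
Proof.
move=> lK Il jn /and4P[_ /eqP ->]; have := mg_ge l; have [] := fit lK Il.
by rewrite /infl /lft /rgt => *; apply/and4P; split; lia.
Qed.

Let R_le1 x y : R x y <= 1.
Proof.
apply: sum2_le1 => l m l' m' _ _ _ _ _ _ /andP[/eqP -> _] /andP[/eqP /target_inj[ll' mm'] _].
by split=> //; apply: mm'; rewrite ll'.
Qed.

(** The count changes along a row only where a ray turns into that row. Rays of another box turn
    inside the margin of that box, which is disjoint from this one; rays of the box itself turn
    above its top row. Hence testing a single column in [pass] is enough. *)
Let R_const l j x x' : l < K -> I l -> j < n l ->
  a l <= x + mg l < a l + n l + mg l + mg l ->
  a l <= x' + mg l < a l + n l + mg l + mg l ->
  R x (u l + j) = R x' (u l + j).
Proof.
move=> lK Il jn hx hx'; apply: eq_bigr => l' Il'; apply: eq_bigr => m _.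
congr nat_of_bool; rewrite /post; case: eqP => //= E.
have [ll'|/eqP ll'] := eqVneq l (l' : nat).
  have := tgt_bounds (ltn_ord m); rewrite -E.
  by move: (col l' m) => c; rewrite -ll'; lia.
have lK' := ltn_ord l'; have mN := ltn_ord m.
have := turn_infl lK' Il' mN; rewrite -E.
have := @disj l l' (col l' m) (u l + j) lK Il lK' Il'.
rewrite {1}/infl; have := mg_ge l; move: (col l' m) => c ? dj hi.
have : ~~ [&& a l <= c + mg l, c < a l + n l + mg l, u l <= u l + j + mg l
  & u l + j < u l + n l + mg l] by apply/negP => /dj /(_ hi).
by rewrite !negb_and; lia.
Qed.

(** Row [u l + j] carries the units [j.*2] and [j.*2.+1] of its box; each parity contributes at most
    one. *)
Let pre_le2 x y : s2 (pre x y) <= 2.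
Proof.
have -> : s2 (pre x y) = s2 (fun l m => odd m && pre x y l m)
                       + s2 (fun l m => ~~ odd m && pre x y l m).
  rewrite /s2 /sum2 -!big_split /=; apply: eq_bigr => l _.
  by rewrite -!big_split /=; apply: eq_bigr => m _; case: odd; rewrite ?addn0.
have H (b : bool) : s2 (fun l m => (odd m == b) && pre x y l m) <= 1.
  apply: (@loc_le1 _ _ x y) => [l m lK Il mN /andP[_]|l m m']; first exact: pre_infl.
  by rewrite /pre /row => /andP[/eqP ? /and3P[/eqP ? _ _]] /andP[/eqP ? /and3P[/eqP ? _ _]]; lia.
have := H true; have := H false.
rewrite (_ : s2 (fun l m => (odd m == true) && _) = s2 (fun l m => odd m && pre x y l m)).
  rewrite (_ : s2 (fun l m => (odd m == false) && _) = s2 (fun l m => ~~ odd m && pre x y l m)).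
    by lia.
  by apply: eq_bigr => l _; apply: eq_bigr => m _; rewrite eqbF_neg.
by apply: eq_bigr => l _; apply: eq_bigr => m _; rewrite eqb_id.
Qed.

Let wneg_le1 x y : Wn x y <= 1.
Proof.
apply: (@loc_le1 _ _ x y) => [l m|l m m' /and4P[_ /eqP-> _ _] /and4P[_ /eqP ? _ _]].
  exact: wneg_infl.
by lia.
Qed.

Let wpos_le1 x y : s1 (wpos x y) <= 1.
Proof.
apply: (@loc_le1 _ _ x y) => [l m|l m m' /and4P[_ /eqP-> _ _] /and4P[_ /eqP ? _ _]].
  exact: wpos_infl.
by lia.
Qed.

Let vert_le1 x y : s2 (vert x y) <= 1.
Proof.
apply: (@loc_le1 _ _ x y) => [l m|l m m' /and3P[/eqP-> _ _] /and3P[/eqP h _ _]].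
  exact: vert_infl.
by move: h; rewrite /col; lia.
Qed.

Let spos_le1 x y : s1 (spos x y) <= 1.
Proof.
apply: sum2_le1 => l j l' j' lK Il jn lK' Il' jn' h h'.
have := disj lK Il lK' Il' (spos_infl lK Il jn h) (spos_infl lK' Il' jn' h') => ll'.
rewrite -{}ll' {l'} in h' lK' Il' jn' *; split=> //.
case/and4P: h => [_ /eqP E _ _]; case/and4P: h' => [_ /eqP E' _ _].
by have [? _ _ _] := fit lK Il; have := mg_ge l; move: E E'; rewrite /lft; lia.
Qed.

Let sneg_le1 x y : Sn x y <= 1.
Proof.
apply: (@loc_le1 _ _ x y) => [l m|l m m' /and4P[_ /eqP-> _ _] /and4P[_ /eqP h _ _]].
  exact: sneg_infl.
by move: h; rewrite /rgt; lia.
Qed.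

(** A bypass goes west only to cancel a ray that is present, so the truncated subtraction in [Fw] is
    exact. For [Fs] this follows from the shift by 1, as at most one unit goes south. *)
Let Wn_le_R x y : Wn x y <= R x y.
Proof.
case: (posnP (Wn x y)) => [-> //|/sum2_gt0P[l [j [lK Il jn /and4P[]]]]].
rewrite /pass => pj /eqP yE h1 h2; apply: leq_trans (wneg_le1 x y) _.
rewrite yE (@R_const l j x (a l)) //; have := mg_ge l; have [] := fit lK Il;
  by move: h1 h2; rewrite /lft /rgt; lia.
Qed.

Let Fw x y := Wp x y - Wn x y.
Let Fs x y := (Sp x y).+1 - Sn x y.

Let flow_ok x y : Fw x y + Fs x y + s2 (src x y) = Fw x.+1 y + Fs x y.+1.
Proof.
have := flow_conserved x y; rewrite /Fw /Fs.
have := Wn_le_R x y; have := Wn_le_R x.+1 y; have := sneg_le1 x y; have := sneg_le1 x y.+1.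
by rewrite /Wp; lia.
Qed.

Let Fw_le4 x y : Fw x y <= 4.
Proof.
by rewrite /Fw /Wp; have := pre_le2 x y; have := R_le1 x y; have := wpos_le1 x y; lia.
Qed.

Let Fs_le4 x y : Fs x y <= 4.
Proof. by rewrite /Fs /Sp; have := vert_le1 x y; have := spos_le1 x y; lia. Qed.

Let infl_core l x y : l < K -> I l -> a l <= x <= a l + n l -> u l <= y <= u l + n l ->
  infl l x y.
Proof.
by move=> lK Il hx hy; have := mg_ge l; rewrite /infl => ?; apply/and4P; split; lia.
Qed.

Let Wn_eq_R l j x : l < K -> I l -> j < n l -> a l <= x <= a l + n l ->
  Wn x (u l + j) = R x (u l + j).
Proof.
move=> lK Il jn hx; apply/eqP; rewrite eqn_leq Wn_le_R /=.
have RE : R x (u l + j) = R (a l) (u l + j).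
  by apply: R_const => //; have := mg_ge l; have [] := fit lK Il; lia.
case: (posnP (R x (u l + j))) => [-> //|Rgt0].
apply: leq_trans (R_le1 _ _) _; apply: (sum2_ge1 lK Il jn).
by rewrite /wneg /pass -RE Rgt0 eqxx /lft /rgt /=; have := mg_ge l; have [] := fit lK Il; lia.
Qed.

Let wpos_row l x y : l < K -> I l -> a l <= x <= a l + n l -> u l <= y < u l + n l ->
  s1 (wpos x y) = 0.
Proof.
move=> lK Il hx hy; apply: sum2_eq0 => l' j lK' Il' jn h.
have ll' : l' = l.
  by apply: (disj lK' Il' lK Il (wpos_infl lK' Il' jn h)); apply: infl_core => //; lia.
by move: h; rewrite ll' => /and4P[_ /eqP h _ _]; lia.
Qed.

(** Any ray that would hit the box is cancelled by its bypass before it reaches the west side. *)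
Let Fw_left l y : l < K -> I l -> u l <= y < u l + n l -> Fw (a l) y = 0.
Proof.
move=> lK Il hy; rewrite /Fw /Wp (@wpos_row l) ?leqnn ?leq_addr // addn0.
have -> : s2 (pre (a l) y) = 0.
  apply: sum2_eq0 => l' m lK' Il' mN h.
  have ll' : l' = l.
    by apply: (disj lK' Il' lK Il (pre_infl lK' Il' mN h)); apply: infl_core => //; lia.
  by move: h; rewrite ll' => /and3P[_ h _]; move: h; rewrite /start; lia.
by rewrite (_ : y = u l + (y - u l)) ?(Wn_eq_R lK Il) ?subnn //; lia.
Qed.

(** Odd units start one column further east, so only unit [(y - u l).*2], the one coming out of the
    box, crosses this edge. *)
Let Fw_right l y : l < K -> I l -> u l <= y < u l + n l -> Fw (a l + n l) y = 1.
Proof.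
move=> lK Il hy; rewrite /Fw /Wp (@wpos_row l) ?leqnn ?leq_addr // addn0.
have -> : s2 (pre (a l + n l) y) = 1.
  apply/eqP; rewrite eqn_leq; apply/andP; split; last first.
    apply: (@sum2_ge1 _ _ _ _ l (y - u l).*2) => //; first by rewrite /N; lia.
    by rewrite /pre /row /start /col odd_double doubleK; lia.
  apply: sum2_le1 => l1 m1 l2 m2 lK1 Il1 mN1 lK2 Il2 mN2 h1 h2.
  have E l' m : l' < K -> I l' -> m < N l' -> pre (a l + n l) y l' m -> l' = l.
    move=> lK' Il' mN h.
    by apply: (disj lK' Il' lK Il (pre_infl lK' Il' mN h)); apply: infl_core => //; lia.
  have e1 := E _ _ lK1 Il1 mN1 h1; have e2 := E _ _ lK2 Il2 mN2 h2.
  move: h1 h2; rewrite e1 e2 => h1 h2.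
  split=> //; move: h1 h2; rewrite /pre /row /start.
  by move=> /and3P[/eqP ? ? _] /and3P[/eqP ? ? _]; lia.
rewrite (_ : y = u l + (y - u l)) ?(Wn_eq_R lK Il) ?addnK //; lia.
Qed.

Let Fs_core l x y : l < K -> I l -> a l <= x < a l + n l -> u l <= y <= u l + n l ->
  Fs x y = 1.
Proof.
move=> lK Il hx hy; rewrite /Fs /Sp.
have hi : infl l x y by apply: infl_core => //; lia.
have [fa _ _ _] := fit lK Il; have mgl := mg_ge l.
have -> : s2 (vert x y) = 0.
  apply: sum2_eq0 => l' m lK' Il' mN h.
  have ll' := disj lK' Il' lK Il (vert_infl lK' Il' mN h) hi.
  by move: h; rewrite ll' => /and3P[/eqP + _ _]; rewrite /col; lia.
have -> : s1 (spos x y) = 0.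
  apply: sum2_eq0 => l' j lK' Il' jn h.
  have ll' := disj lK' Il' lK Il (spos_infl lK' Il' jn h) hi.
  by move: h jn; rewrite ll' => /and4P[_ /eqP + _ _]; rewrite /lft; lia.
have -> // : Sn x y = 0.
apply: sum2_eq0 => l' j lK' Il' jn h.
have ll' := disj lK' Il' lK Il (sneg_infl lK' Il' jn h) hi.
by move: h jn; rewrite ll' => /and4P[_ /eqP + _ _]; rewrite /rgt; lia.
Qed.

Let Fs_0 x : Fs x 0 = 1.
Proof.
rewrite /Fs /Sp.
have -> : s2 (vert x 0) = 0 by apply: sum2_eq0 => l m lK Il _ /and3P[_]; rewrite ltn0.
have -> : s1 (spos x 0) = 0 by apply: sum2_eq0 => l m lK Il _ /and4P[_ _]; rewrite ltn0.
by have -> : Sn x 0 = 0 by apply: sum2_eq0 => l m lK Il _ /and4P[_ _]; rewrite ltn0.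
Qed.

(** East of all margins only the final rays survive, in distinct rows: the large square inherits the
    interface of the boxes. *)
Let Fw_L y : Fw L y <= 1.
Proof.
rewrite /Fw /Wp.
have -> : s2 (pre L y) = 0.
  apply: sum2_eq0 => l m lK Il mN /and3P[_ _]; move: mN.
  by have := mg_ge l; have [] := fit lK Il; rewrite /col /N; lia.
have -> : s1 (wpos L y) = 0.
  apply: sum2_eq0 => l m lK Il mn /and4P[_ _ _]; move: mn.
  by have := mg_ge l; have [] := fit lK Il; rewrite /rgt; lia.
by have := R_le1 L y; lia.
Qed.

Let Fs_L x : Fs x L = 1.
Proof.
rewrite /Fs /Sp.
have -> : s2 (vert x L) = 0.
  apply: sum2_eq0 => l m lK Il mN /and3P[_ _]; have := tgt_bounds mN.
  by have [] := fit lK Il; lia.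
have -> : s1 (spos x L) = 0.
  apply: sum2_eq0 => l m lK Il mn /and4P[_ _ _]; move: mn.
  by have := mg_ge l; have [] := fit lK Il; lia.
have -> // : Sn x L = 0.
apply: sum2_eq0 => l m lK Il mn /and4P[_ _ _]; move: mn.
by have := mg_ge l; have [] := fit lK Il; lia.
Qed.

Let src_right l y : l < K -> I l -> u l <= y < u l + n l -> 0 < s2 (src (a l + n l) y).
Proof.
move=> lK Il hy; apply: (@sum2_ge1 _ _ _ _ l (y - u l).*2.+1) => //.
  by rewrite /N; lia.
by rewrite /src /row /start /= odd_double /=; lia.
Qed.

(** * Gluing the old squares into the routed flow *)

Variables (oW oS : nat -> nat -> nat) (oG : nat -> nat -> bool).

Definition inbox x y := has (fun l => I l && inb l x y) (iota 0 K).

Let inboxP x y : reflect (exists l, [/\ l < K, I l & inb l x y]) (inbox x y).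
Proof.
apply: (iffP hasP) => [[l]|[l [lK Il h]]].
  by rewrite mem_iota add0n /= => lK /andP[Il h]; exists l.
by exists l; rewrite ?mem_iota ?add0n ?Il.
Qed.

Hypothesis old_bounds : forall x y, inbox x y -> oW x y <= 4 /\ oS x y <= 4.
Hypothesis old_bottom : forall l x, l < K -> I l -> a l <= x < a l + n l -> oS x (u l) = 1.
(** Outside the box both default values are 1: one unit may leave to the east, whereas the shifted
    vertical flow 1 stands for 0. *)
Hypothesis old_flow : forall l x y, l < K -> I l -> inb l x y ->
  oW x y + oS x y + (inb l x.+1 y && (oG x y == oG x.+1 y)) <=
  (if inb l x.+1 y then oW x.+1 y else 1) + (if inb l x y.+1 then oS x y.+1 else 1).

(* Filled from right to left; a cell just right of a box must differ from the
   box, so its own right edge is the only place where the colouring may fail. *)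
Fixpoint fill k y :=
  if inbox (L - k) y then oG (L - k) y
  else if (k < L) && inbox (L - k).-1 y then ~~ oG (L - k).-1 y
  else if k is k'.+1 then ~~ fill k' y else true.

Let nG x y := fill (L - x) y.
Let nW x y := if inbox x y then oW x y else Fw x y.
Let nS x y := if inbox x y then oS x y else Fs x y.

Let nG_box x y : x <= L -> inbox x y -> nG x y = oG x y.
Proof. by move=> xL h; rewrite /nG; case E : (L - x) => [|k] /=; rewrite -E subKn // h. Qed.

Let nG_right x y : x < L -> inbox x y -> ~~ inbox x.+1 y -> nG x.+1 y = ~~ oG x y.
Proof.
move=> xL h /negbTE h'; rewrite /nG.
have E : L - (L - x.+1) = x.+1 by lia.
have kL : L - x.+1 < L by lia.
by case Ek : (L - x.+1) E kL => [|k] /= -> /= ->; rewrite h' h.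
Qed.

Let nG_free x y : x < L -> ~~ inbox x y -> ~~ ((0 < x) && inbox x.-1 y) ->
  nG x y = ~~ nG x.+1 y.
Proof.
move=> xL /negbTE h /negbTE h'; rewrite /nG.
have -> : L - x = (L - x.+1).+1 by lia.
rewrite /=; have -> : L - (L - x.+1).+1 = x by lia.
have -> : ((L - x.+1).+1 < L) = (0 < x) by lia.
by rewrite h h'.
Qed.

Lemma merge_boxes : exists (nW nS : nat -> nat -> nat) (nG : nat -> nat -> bool),
  [/\ forall x y, x < L -> inbox x y ->
        [/\ nW x y = oW x y, nS x y = oS x y & nG x y = oG x y],
      forall x y, nW x y <= 4 /\ nS x y <= 4,
      forall x, nS x 0 = 1 &
      forall x y, x < L -> y < L ->
        nW x y + nS x y + ((x.+1 < L) && (nG x y == nG x.+1 y)) <=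
        (if x.+1 < L then nW x.+1 y else 1) + (if y.+1 < L then nS x y.+1 else 1)].
Proof.
have core l x y : l < K -> I l -> inb l x y -> infl l x y.
  by move=> lK Il /and4P[*]; apply: infl_core => //; lia.
exists nW, nS, nG; split.
- by move=> x y xL h; rewrite nG_box // ?(ltnW xL) // /nW /nS h.
- by move=> x y; rewrite /nW /nS; case: ifP => [/old_bounds|].
- move=> x; rewrite /nS; case: inboxP => // -[l [lK Il /and4P[_ _ h _]]].
  by have := mg_ge l; have [] := fit lK Il; lia.
move=> x y xL yL; case: (inboxP x y) => [[l [lK Il h]]|pF].
  have hin : inbox x y by apply/inboxP; exists l.
  have /and4P[h1 h2 h3 h4] := h.
  have [xL' yL'] : x.+1 < L /\ y.+1 < L.
    by have := mg_ge l; have [] := fit lK Il; lia.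
  have uniq x' y' : a l <= x' <= a l + n l -> u l <= y' <= u l + n l ->
      inbox x' y' -> inb l x' y'.
    move=> hx hy /inboxP[l' [lK' Il' h']].
    by rewrite (disj lK Il lK' Il' (infl_core lK Il hx hy) (core _ _ _ lK' Il' h')).
  have := old_flow lK Il h; rewrite xL' yL' /nW /nS hin /=.
  have -> : (if inbox x y.+1 then oS x y.+1 else Fs x y.+1) =
            (if inb l x y.+1 then oS x y.+1 else 1).
    case: (boolP (inb l x y.+1)) => [hi|/negP hi].
      by rewrite (_ : inbox x y.+1) //; apply/inboxP; exists l.
    case: ifP => [/uniq hi'|_]; first by case: hi; apply: hi'; lia.
    by apply: (@Fs_core l) => //; lia.
  case: (boolP (inb l x.+1 y)) => [hi|/negP hi].
    have hin' : inbox x.+1 y by apply/inboxP; exists l.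
    by rewrite hin' !nG_box // ltnW.
  have hin' : ~~ inbox x.+1 y by apply/negP => /uniq hi'; case: hi; apply: hi'; lia.
  (* On the east edge the routing takes over the outgoing unit, and [fill] changes the colour, so
     there is no defect to pay for. *)
  have xE : x.+1 = a l + n l by apply/eqP; move/negP: hi; rewrite /inb; lia.
  rewrite (negbTE hin') nG_right // nG_box ?(ltnW xL) // xE Fw_right //; last by lia.
  by rewrite (_ : (oG x y == ~~ oG x y) = false) //; case: (oG x y).
have nF : ~~ inbox x y by apply/negP => /inboxP.
(* Entering a box can only increase the recorded flow: from the west the routing delivers 0, which
   any [oW] dominates; from the south it delivers the shifted value 1, met by [old_bottom]. *)
have nWE : (if x.+1 < L then nW x.+1 y else 1) >= Fw x.+1 y.
  case: ltnP => [xL'|xL']; last by rewrite (_ : x.+1 = L) ?Fw_L //; lia.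
  rewrite /nW; case: inboxP => // -[l [lK Il h]].
  have xE : x.+1 = a l.
    apply/eqP/negPn/negP => ne; apply: pF; exists l; split=> //.
    by move: h; rewrite /inb; lia.
  by rewrite xE Fw_left //; move: h; rewrite /inb; lia.
have nSE : (if y.+1 < L then nS x y.+1 else 1) >= Fs x y.+1.
  case: ltnP => [yL'|yL']; last by rewrite (_ : y.+1 = L) ?Fs_L //; lia.
  rewrite /nS; case: inboxP => // -[l [lK Il h]].
  have yE : y.+1 = u l.
    apply/eqP/negPn/negP => ne; apply: pF; exists l; split=> //.
    by move: h; rewrite /inb; lia.
  by rewrite yE old_bottom ?(@Fs_core l) //; move: h; rewrite /inb; lia.
apply: leq_trans (leq_add nWE nSE); rewrite -flow_ok /nW /nS (negbTE nF) leq_add2l.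
case: andP => // -[xL' /eqP nGE].
(* A defect outside the boxes can occur only just east of a box, and there the odd unit has its
   source. *)
case: (boolP ((0 < x) && inbox x.-1 y)) => [/andP[x0 /inboxP[l [lK Il h]]]|h].
  have xE : x = a l + n l.
    apply/eqP/negPn/negP => ne; apply: pF; exists l; split=> //.
    by move: h; rewrite /inb; lia.
  by rewrite xE src_right //; move: h; rewrite /inb; lia.
by have := nG_free xL nF h; rewrite nGE; case: (nG _ _).
Qed.

End Routing.

(** * The labelling strategy *)

Definition npair p q := (p + q) ^ 2 + p.

(** As [p <= p + q], the code lies between [(p + q) ^ 2] and the next square, which determines
    [p + q]. *)
Lemma npair_inj p q p' q' : npair p q = npair p' q' -> p = p' /\ q = q'.
Proof.
rewrite /npair -!mulnn => E.
have H a b a' b' : (a + b) * (a + b) + a = (a' + b') * (a' + b') + a' ->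
    a' + b' <= a + b.
  rewrite [leqRHS]lock; case: leqP => // h E'.
  by have := leq_mul h h; rewrite -lock mulSn !mulnS; lia.
have : p + q = p' + q' by apply/eqP; rewrite eqn_leq !(H _ _ _ _ E, H _ _ _ _ (esym E)).
by move=> pq; move: E; rewrite pq; lia.
Qed.

Lemma npair_ge p q : p <= npair p q /\ q <= npair p q.
Proof. by rewrite /npair -mulnn; nia. Qed.

Definition nfst z :=
  find (fun p => has (fun q => npair p q == z) (iota 0 z.+1)) (iota 0 z.+1).
Definition nsnd z :=
  find (fun q => has (fun p => npair p q == z) (iota 0 z.+1)) (iota 0 z.+1).

Lemma find_iota (P : pred nat) b i : i < b -> P i -> (forall j, P j -> j = i) ->
  find P (iota 0 b) = i.
Proof.
move=> ib Pi Puniq; have h : has P (iota 0 b).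
  by apply/hasP; exists i; rewrite ?mem_iota.
by apply: Puniq; have := nth_find 0 h; rewrite nth_iota // -[X in _ < X](size_iota 0) -has_find.
Qed.

Lemma nfstK p q : nfst (npair p q) = p.
Proof.
have [hp hq] := npair_ge p q; apply: find_iota; first by rewrite ltnS.
  by apply/hasP; exists q; rewrite ?mem_iota ?ltnS.
by move=> j /hasP[q' _ /eqP/npair_inj[]].
Qed.

Lemma nsndK p q : nsnd (npair p q) = q.
Proof.
have [hp hq] := npair_ge p q; apply: find_iota; first by rewrite ltnS.
  by apply/hasP; exists p; rewrite ?mem_iota ?ltnS.
by move=> j /hasP[q' _ /eqP/npair_inj[]].
Qed.

(* Tables of labels are numbers in base 51 = 5 * 5 * 2 + 1; the digit 0 stands for
   an unlabelled point. *)
Definition digit T p := (T %/ 51 ^ p) %% 51.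

Lemma digit_small T p : T <= p -> digit T p = 0.
Proof.
by move=> Tp; rewrite /digit divn_small // (leq_ltn_trans Tp) // ltn_expl.
Qed.

Lemma digit_table (F : nat -> nat) P : (forall p, F p < 51) ->
  (forall p, P <= p -> F p = 0) -> exists T, forall p, digit T p = F p.
Proof.
elim: P F => [|P IH] F Flt Fz; first by exists 0 => p; rewrite Fz // /digit div0n.
have [T TF] := IH (fun p => F p.+1) (fun p => Flt p.+1) (fun p h => Fz p.+1 h).
exists (F 0 + T * 51) => -[|p]; rewrite /digit.
  by rewrite expn0 divn1 addnC modnMDl modn_small.
by rewrite expnS divnMA addnC divnMDl // (divn_small (Flt 0)) addn0 -TF.
Qed.

Definition entW d := d.-1 %/ 10.
Definition entS d := (d.-1 %% 10) %/ 2.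
Definition entG d := odd d.-1.

Lemma entK w s (g : bool) : w <= 4 -> s <= 4 ->
  let d := (w * 10 + s * 2 + g).+1 in
  [/\ d < 51, entW d = w, entS d = s & entG d = g].
Proof. by rewrite /entW /entS /entG /= => *; split; case: g; lia. Qed.

Lemma entE d : d != 0 -> (entW d * 10 + entS d * 2 + entG d).+1 = d.
Proof.
rewrite /entW /entS /entG -modn2; have : (d.-1 %% 10) %% 2 = d.-1 %% 2 by rewrite modn_dvdm.
by have := divn_eq d.-1 10; have := divn_eq (d.-1 %% 10) 2; lia.
Qed.

Lemma ent_bounds T p : entW (digit T p) <= 4 /\ entS (digit T p) <= 4.
Proof.
have : digit T p < 51 by rewrite ltn_mod.
rewrite /entW /entS; move: (digit T p) => d dlt; split.
  by rewrite -ltnS ltn_divLR //; lia.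
by rewrite -ltnS ltn_divLR // ltn_mod.
Qed.

(** * Stages and their decidable conditions *)

Section Strategy.
Variables (X : pred nat) (a1 a2 : nat -> nat).

(* Stage [k] creates the box coded by [z]: [corner z] is the lower left corner of
   a square of side [width k z], in which a square of side [side z] is labelled,
   leaving a margin free on all sides. *)
Definition pt c i j := iter j a2 (iter i a1 c).
Definition corner z := nfst z.
Definition side z := nfst (nsnd z).
Definition table z := nsnd (nsnd z).
Definition width k z := side z + 2 * margin k (side z).

Definition inner k z p :=
  has (fun x => has (fun y =>
    pt (corner z) (margin k (side z) + x) (margin k (side z) + y) == p)
    (iota 0 (side z))) (iota 0 (side z)).
Definition outer k z p :=
  has (fun x => has (fun y => pt (corner z) x y == p)
    (iota 0 (width k z))) (iota 0 (width k z)).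

Definition all_outer k z (P : pred nat) :=
  all (fun x => all (fun y => P (pt (corner z) x y))
    (iota 0 (width k z))) (iota 0 (width k z)).

Definition cell k z x y :=
  digit (table z) (pt (corner z) (margin k (side z) + x) (margin k (side z) + y)).

(* The flow into the box from the south vanishes ([entS] is shifted by 1), while
   one unit leaves every row to the east. *)
Definition cell_ok k z x y :=
  [&& cell k z x y != 0,
      (y == 0) ==> (entS (cell k z x y) == 1) &
      entW (cell k z x y) + entS (cell k z x y)
      + ((x.+1 < side z) && (entG (cell k z x y) == entG (cell k z x.+1 y)))
      <= (if x.+1 < side z then entW (cell k z x.+1 y) else 1)
       + (if y.+1 < side z then entS (cell k z x y.+1) else 1)].

Definition extends k z T p :=
  ((digit T p != 0) ==> (digit (table z) p == digit T p)) &&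
  ((digit (table z) p != 0) ==> ((digit T p != 0) || inner k z p)).

(* [s] lists the boxes of the earlier stages, the latest first. *)
Definition entry s k i := nfst (iter (k - i.+1) nsnd s).
Definition last_table s := table (nfst s).

(** A decidable substitute for comparing orbits: the finitely many points of the earlier square [w],
    margin included, are tested one by one. Side 0 marks a stage that created no box. *)
Definition separated k z i w :=
  [|| side w == 0, all_outer i w (inner k z) |
      all_outer i w (fun p => ~~ outer k z p)].

(** From [last_table s + table z] on, both tables have only zero digits, so the bounded check of
    [extends] covers all points. *)
Definition new_box k s z :=
  [&& X (corner z), inner k z k,
      all (fun i => separated k z i (entry s k i)) (iota 0 k),
      all (extends k z (last_table s)) (iota 0 (last_table s + table z)) &
      all (fun x => all (cell_ok k z x) (iota 0 (side z))) (iota 0 (side z))].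

Definition stage_ok k s z :=
  if X k && (digit (last_table s) k == 0) then new_box k s z
  else z == npair 0 (npair 0 (last_table s)).

Definition choose_box k s :=
  if pselect (exists z, stage_ok k s z) is left e then ex_minn e else 0.

Fixpoint history k :=
  if k is k'.+1 then npair (choose_box k' (history k')) (history k') else 0.

Definition box k := choose_box k (history k).

Lemma entry_history k i : i < k -> entry (history k) k i = box i.
Proof.
rewrite /entry; elim: k => // k IH; rewrite ltnS leq_eqVlt => /predU1P[->|ik].
  by rewrite subnn /= nfstK.
have -> : k.+1 - i.+1 = (k - i.+1).+1 by lia.
by rewrite iterSr /= nsndK IH.
Qed.

Definition tab k := last_table (history k).

Lemma tab0 : tab 0 = 0.
Proof.
rewrite /tab /last_table /table -[history 0]/(npair 0 0) nfstK.
by rewrite -[0]/(npair 0 (npair 0 0)) !nsndK.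
Qed.

Lemma tabS k : tab k.+1 = table (box k).
Proof. by rewrite /tab /last_table /= nfstK. Qed.

Lemma innerP k z p : reflect
  (exists x y, [/\ x < side z, y < side z &
    pt (corner z) (margin k (side z) + x) (margin k (side z) + y) = p])
  (inner k z p).
Proof.
apply: (iffP hasP) => [[x]|[x [y [xs ys h]]]].
  rewrite mem_iota add0n => /= xs /hasP[y]; rewrite mem_iota add0n => /= ys /eqP h.
  by exists x, y.
exists x; first by rewrite mem_iota.
by apply/hasP; exists y; [rewrite mem_iota|apply/eqP].
Qed.

Lemma outerP k z p : reflect
  (exists x y, [/\ x < width k z, y < width k z & pt (corner z) x y = p])
  (outer k z p).
Proof.
apply: (iffP hasP) => [[x]|[x [y [xs ys h]]]].
  rewrite mem_iota add0n => /= xs /hasP[y]; rewrite mem_iota add0n => /= ys /eqP h.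
  by exists x, y.
exists x; first by rewrite mem_iota.
by apply/hasP; exists y; [rewrite mem_iota|apply/eqP].
Qed.

Lemma all_outerP k z (P : pred nat) :
  reflect (forall p, outer k z p -> P p) (all_outer k z P).
Proof.
apply: (iffP allP) => [h p /outerP[x [y [xw yw <-]]]|h x].
  by apply: (allP (h x _)); rewrite mem_iota.
rewrite mem_iota add0n => /= xw; apply/allP => y; rewrite mem_iota add0n => /= yw.
by apply: h; apply/outerP; exists x, y.
Qed.

Lemma inner_outer k z p : inner k z p -> outer k z p.
Proof.
case/innerP => x [y [xs ys <-]]; apply/outerP.
exists (margin k (side z) + x), (margin k (side z) + y).
by rewrite /width; split=> //; lia.
Qed.

(** * Maximal squares after finitely many stages *)

Section Trajectory.
Variable K : nat.
Hypothesis ok : forall k, k < K -> stage_ok k (history k) (box k).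

Lemma box_ok k : k < K -> side (box k) != 0 -> new_box k (history k) (box k).
Proof.
move=> /ok; rewrite /stage_ok; case: ifP => // _ /eqP ->.
by rewrite /side nsndK nfstK.
Qed.

Lemma extendsP k p : k < K ->
  [/\ digit (tab k) p != 0 -> digit (tab k.+1) p = digit (tab k) p &
      digit (tab k.+1) p != 0 -> digit (tab k) p != 0 \/
        side (box k) != 0 /\ inner k (box k) p].
Proof.
move=> kK; rewrite tabS; have := ok kK; rewrite /stage_ok.
case: ifP => _; last by move/eqP => ->; rewrite /table !nsndK; split=> // ->; left.
case/and5P => _ hk _ hx _.
have side0 : side (box k) != 0.
  by move/innerP: hk => [x [y [h _ _]]]; rewrite -lt0n; apply: leq_ltn_trans h.
have {hx} : extends k (box k) (tab k) p.
  case: (ltnP p (tab k + table (box k))) => hp.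
    by apply: (allP hx); rewrite mem_iota.
  by rewrite /extends !digit_small //; lia.
case/andP => /implyP h1 /implyP h2; split=> [/h1/eqP //|/h2/orP[|]]; by [left|right].
Qed.

Lemma tab_persist k k' p : k <= k' <= K -> digit (tab k) p != 0 ->
  digit (tab k') p = digit (tab k) p.
Proof.
case/andP; elim: k' => [|k' IH]; first by rewrite leqn0 => /eqP ->.
rewrite leq_eqVlt => /predU1P[-> //|]; rewrite ltnS => kk' k'K h.
have E := IH kk' (ltnW k'K) h.
by have [-> //] := extendsP p k'K; rewrite E.
Qed.

Lemma labeled_inner k p : k <= K -> digit (tab k) p != 0 ->
  exists i, [/\ i < k, side (box i) != 0 & inner i (box i) p].
Proof.
elim: k => [|k IH] kK; first by rewrite tab0 /digit div0n.
case: (extendsP p kK) => _ h /h[/(IH (ltnW kK))[i [ik si hi]]|[sk hk]].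
  by exists i; split=> //; apply: ltnW.
by exists k.
Qed.

Lemma cellE k x y : cell k (box k) x y = digit (tab k.+1)
  (pt (corner (box k)) (margin k (side (box k)) + x) (margin k (side (box k)) + y)).
Proof. by rewrite tabS. Qed.

(** The boxes that no later box has swallowed: by [separated], disjointness is the only
    alternative. *)
Definition active l := [&& l < K, side (box l) != 0 & all (fun j =>
  (l < j) ==> ((side (box j) == 0) || all_outer l (box l) (fun p => ~~ outer j (box j) p)))
  (iota 0 K)].

Lemma active_disjoint l l' p : active l -> active l' ->
  outer l (box l) p -> outer l' (box l') p -> l = l'.
Proof.
wlog ll' : l l' / l < l' => [hw|].
  by case: (ltngtP l l') => // h *; [|symmetry]; apply: hw.
move=> /and3P[lK sl /allP al] /and3P[lK' sl' _] o o'.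
have := al l'; rewrite mem_iota ll' => /(_ lK').
by rewrite (negbTE sl') => /all_outerP/(_ p o); rewrite o'.
Qed.

(** Take the last box with [p] in its inner square. A later box not disjoint from it would contain
    it, and hence [p], in its own inner square. *)
Lemma active_cover p : digit (tab K) p != 0 -> exists2 l, active l & inner l (box l) p.
Proof.
move=> /(labeled_inner (leqnn K))[i0 [i0K s0 in0]].
pose Q i := [&& i < K, side (box i) != 0 & inner i (box i) p].
have exQ : exists i, Q i by exists i0; apply/and3P.
have ubQ i : Q i -> i <= K by case/and3P => /ltnW.
case: (ex_maxnP exQ ubQ) => l /and3P[lK sl il] lmax; exists l => //.
rewrite /active lK sl; apply/allP => j; rewrite mem_iota add0n => /= jK.
apply/implyP => lj; case: eqVneq => //= sj.
have /and5P[_ _ /allP/(_ l) + _ _] := box_ok jK sj.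
rewrite mem_iota add0n lj entry_history // => /(_ isT)/or3P[|/all_outerP h|//].
  by rewrite (negbTE sl).
have := lmax j; rewrite /Q jK sj h; last exact: inner_outer.
by rewrite leqNgt lj => /(_ isT).
Qed.

End Trajectory.

(** * Orbits under the two generators *)

Variable orb : int -> int -> nat -> nat.
Hypothesis orbX : forall i j p, X p -> X (orb i j p).
Hypothesis orb0 : forall p, X p -> orb 0 0 p = p.
Hypothesis orbD : forall i j i' j' p, X p ->
  orb i j (orb i' j' p) = orb (i + i')%R (j + j')%R p.
Hypothesis orb_free : forall i j p, X p -> orb i j p = p -> i = 0%R /\ j = 0%R.
Hypothesis a1E : forall p, X p -> a1 p = orb 1 0 p.
Hypothesis a2E : forall p, X p -> a2 p = orb 0 1 p.

Lemma orb_inj i j i' j' p : X p -> orb i j p = orb i' j' p -> i = i' /\ j = j'.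
Proof.
move=> Xp E; have : orb (- i')%R (- j')%R (orb i j p) = p.
  by rewrite E orbD // !GRing.addNr orb0.
by rewrite orbD // => /(orb_free Xp)[]; lia.
Qed.

Lemma ptE c i j : X c -> pt c i j = orb i j c.
Proof.
move=> Xc; have H1 : iter i a1 c = orb i 0 c.
  elim: i => [|i IH]; first by rewrite orb0.
  by rewrite /= IH a1E ?orbX // orbD //; congr orb; lia.
rewrite /pt H1; elim: j => [//|j IH].
by rewrite /= IH a2E ?orbX // orbD //; congr orb; lia.
Qed.

(** * Existence of the next square *)

Section Extension.
Variable K : nat.
Hypothesis ok : forall k, k < K -> stage_ok k (history k) (box k).
Hypotheses (XK : X K) (newK : digit (tab K) K = 0).

Let cornerX l : l < K -> side (box l) != 0 -> X (corner (box l)).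
Proof. by move=> lK sl; have /and5P[] := box_ok ok lK sl. Qed.

Let near l := exists al be, corner (box l) = orb al be K.

Let offsets : exists al be : nat -> int, forall l, near l ->
  corner (box l) = orb (al l) (be l) K.
Proof.
have H l : {ab : int * int | near l -> corner (box l) = orb ab.1 ab.2 K}.
  apply: cid; case: (pselect (near l)) => [[al [be h]]|nl]; first by exists (al, be).
  by exists (0, 0)%R.
by exists (fun l => (sval (H l)).1), (fun l => (sval (H l)).2) => l; case: (H l).
Qed.

Let boundary (al be : nat -> int) : exists D, forall l, l < K ->
  `|al l| + width l (box l) <= D /\ `|be l| + width l (box l) <= D.
Proof.
exists (\max_(l < K) (`|al l| + `|be l| + width l (box l))) => l lK.
have := @leq_bigmax _ (fun l : 'I_K => `|al l| + `|be l| + width l (box l)) (Ordinal lK).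
by rewrite /=; lia.
Qed.

(** The square is centred at [K]. Its half-width [D] exceeds the distance from [K] to every earlier
    box, margin included, that lies in the orbit of [K]. The active ones among these are the boxes
    passed to [merge_boxes], in coordinates relative to the lower left corner of the inner
    square. *)
Lemma new_box_exists : exists z, new_box K (history K) z.
Proof.
have [al [be offE]] := offsets; have [D DP] := boundary al be.
pose L := D.*2.+1; pose m := margin K L.
pose c := orb (- (D + m)%:Z)%R (- (D + m)%:Z)%R K.
have Xc : X c by apply: orbX.
have cE x y : pt c (m + x) (m + y) = orb (x%:Z - D%:Z)%R (y%:Z - D%:Z)%R K.
  by rewrite ptE // orbD //; congr orb; lia.
pose a l := absz (al l + (D + margin l (side (box l)))%:Z)%R.
pose u l := absz (be l + (D + margin l (side (box l)))%:Z)%R.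
pose n l := side (box l).
pose I l := active K l && `[< near l >].
have IP l : I l -> [/\ l < K, active K l, side (box l) != 0, X (corner (box l)) &
    corner (box l) = orb (al l) (be l) K].
  case/andP => al' /asboolP nl; have /and3P[lK sl _] := al'.
  by split=> //; [apply: cornerX|apply: offE].
have auE l : I l -> (a l)%:Z%R = (al l + (D + margin l (n l))%:Z)%R /\
                    (u l)%:Z%R = (be l + (D + margin l (n l))%:Z)%R.
  move/IP=> [lK _ _ _ _]; have := DP l lK; rewrite /a /u /n /width.
  by move: (margin _ _) => mm; lia.
have boxE l x y : X (corner (box l)) -> corner (box l) = orb (al l) (be l) K ->
    pt (corner (box l)) x y = orb (al l + x%:Z)%R (be l + y%:Z)%R K.
  by move=> Xl E; rewrite ptE // E orbD //; congr orb; lia.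
have fit l : l < K -> I l -> [/\ margin l (n l) <= a l, margin l (n l) <= u l,
    a l + n l + margin l (n l) <= L & u l + n l + margin l (n l) <= L].
  move=> lK Il; have := DP l lK; have := auE l Il; rewrite /width /L -/(n l).
  by move: (margin _ _) => mm; split; lia.
have inflE l x y : I l -> infl a u n l x y ->
    outer l (box l) (orb (x%:Z - D%:Z)%R (y%:Z - D%:Z)%R K).
  move=> Il /and4P[h1 h2 h3 h4]; apply/outerP.
  have := auE l Il; move: h1 h2 h3 h4; rewrite /width -/(n l).
  have [_ _ _ Xl E] := IP l Il.
  move: (margin _ _) (fun x y => boxE l x y Xl E) => mm bE h1 h2 h3 h4 [aE uE].
  exists (x + mm - a l), (y + mm - u l); split; [lia|lia|].
  by rewrite bE; congr orb; lia.
have disj l l' x y : l < K -> I l -> l' < K -> I l' ->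
    infl a u n l x y -> infl a u n l' x y -> l = l'.
  move=> _ Il _ Il' /(inflE _ _ _ Il) o /(inflE _ _ _ Il') o'.
  by have [_ h _ _ _] := IP l Il; have [_ h' _ _ _] := IP l' Il';
    exact: (active_disjoint h h' o o').
pose d x y := digit (tab K) (pt c (m + x) (m + y)).
have okP l x y : I l -> x < n l -> y < n l -> cell_ok l (box l) x y.
  move=> /IP[lK _ sl _ _] xn yn; have /and5P[_ _ _ _ /allP h] := box_ok ok lK sl.
  by apply: (allP (h x _)); rewrite mem_iota.
have cellP l x y : I l -> inb a u n l x y ->
    [/\ x - a l < n l, y - u l < n l & cell l (box l) (x - a l) (y - u l) = d x y].
  move=> Il /and4P[h1 h2 h3 h4].
  have xn : x - a l < n l by lia.
  have yn : y - u l < n l by lia.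
  split=> //; have [lK _ sl Xl E] := IP l Il.
  have /and3P[nz _ _] := okP l _ _ Il xn yn.
  move: nz; rewrite /d cE cellE boxE // -/(n l).
  have -> : orb (al l + (margin l (n l) + (x - a l))%:Z)%R
    (be l + (margin l (n l) + (y - u l))%:Z)%R K = orb (x%:Z - D%:Z)%R (y%:Z - D%:Z)%R K.
    have := auE l Il; move: (margin _ _) => mm [aE uE]; congr orb; lia.
  by move=> nz; rewrite -(tab_persist ok (k := l.+1) (k' := K)) // lK leqnn.
have inboxP x y : inbox K I a u n x y -> exists l, [/\ l < K, I l & inb a u n l x y].
  by case/hasP => l; rewrite mem_iota => /= lK /andP[Il h]; exists l.
have d_inbox x y : inbox K I a u n x y -> d x y != 0.
  case/inboxP => l [_ Il h]; have [xn yn <-] := cellP l x y Il h.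
  by have /and3P[] := okP l _ _ Il xn yn.
(* Together with [d_inbox]: inside the new square, labelled points and points of the active boxes
   are the same, so routing changes no label. *)
have inbox_d x y : d x y != 0 -> inbox K I a u n x y.
  case/(active_cover ok) => l al' /innerP[x' [y' [xn yn]]].
  have /and3P[lK sl _] := al'; have Xl := cornerX lK sl.
  rewrite ptE // cE => E.
  have nl : near l.
    exists (x%:Z - D%:Z - (margin l (side (box l)) + x')%:Z)%R,
           (y%:Z - D%:Z - (margin l (side (box l)) + y')%:Z)%R.
    have := congr1 (orb (- (margin l (side (box l)) + x')%:Z)%R
                        (- (margin l (side (box l)) + y')%:Z)%R) E.
    rewrite !orbD // !GRing.addNr orb0 // => ->; congr orb; lia.
  have Il : I l by rewrite /I al'; apply/asboolP.
  apply/hasP; exists l; rewrite ?mem_iota // Il /=.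
  move: E; rewrite -ptE // (boxE l _ _ Xl (offE l nl)) => /(orb_inj XK)[].
  by have := auE l Il; rewrite /inb -/(n l); move: xn yn; rewrite -/(n l); lia.
pose oW x y := entW (d x y); pose oS x y := entS (d x y); pose oG x y := entG (d x y).
have [|||nW [nS [nG [agree bnd bot0 flow]]]] :=
  @merge_boxes K L I a u n fit disj oW oS oG.
- by move=> x y _; apply: ent_bounds.
- move=> l x lK Il xa; have [_ _ sl _ _] := IP l Il.
  have h : inb a u n l x (u l) by rewrite /inb; move: sl; rewrite -/(n l); lia.
  have [xn yn dE] := cellP l _ _ Il h; have /and3P[_ /implyP + _] := okP l _ _ Il xn yn.
  by rewrite dE subnn => /(_ (eqxx _))/eqP.
- move=> l x y lK Il h.
  have [xn yn dE] := cellP l _ _ Il h; have /and3P[_ _] := okP l _ _ Il xn yn.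
  have hx : inb a u n l x.+1 y = ((x - a l).+1 < n l) by move: h; rewrite /inb; lia.
  have hy : inb a u n l x y.+1 = ((y - u l).+1 < n l) by move: h; rewrite /inb; lia.
  rewrite dE -/(n l) -hx -hy /oW /oS /oG.
  have -> : (x - a l).+1 = x.+1 - a l by move: h; rewrite /inb; lia.
  have -> : (y - u l).+1 = y.+1 - u l by move: h; rewrite /inb; lia.
  case: (boolP (inb a u n l x.+1 y)) => [h1|_]; case: (boolP (inb a u n l x y.+1)) => [h2|_] //.
  + by have [_ _ ->] := cellP l _ _ Il h1; have [_ _ ->] := cellP l _ _ Il h2.
  + by have [_ _ ->] := cellP l _ _ Il h1.
  + by have [_ _ ->] := cellP l _ _ Il h2.
pose lab x y := (nW x y * 10 + nS x y * 2 + nG x y).+1.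
pose at_ p (xy : nat * nat) := [/\ xy.1 < L, xy.2 < L & pt c (m + xy.1) (m + xy.2) = p].
have at_uniq p xy xy' : at_ p xy -> at_ p xy' -> xy = xy'.
  case: xy xy' => [x y] [x' y'] [_ _ /= <-] [_ _ /=]; rewrite !cE => /(orb_inj XK).
  by case=> ? ?; congr pair; lia.
(* Old labels take precedence, so those outside the square survive; inside it they agree with [lab].
   Freeness of the action makes the coordinates of a point unique. *)
pose F p := if digit (tab K) p != 0 then digit (tab K) p else
  if pselect (exists xy, at_ p xy) is left e then lab (projT1 (cid e)).1 (projT1 (cid e)).2 else 0.
have F_at x y : x < L -> y < L -> F (pt c (m + x) (m + y)) = lab x y.
  move=> xL yL; rewrite /F; have -> : digit (tab K) (pt c (m + x) (m + y)) = d x y by [].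
  case: ifP => [h|_].
    rewrite /lab; have [-> -> ->] := agree _ _ xL (inbox_d x y h).
    by rewrite entE.
  case: pselect => [e|[]]; last by exists (x, y).
  by case: (cid e) => /= xy h; rewrite (at_uniq _ _ (x, y) h).
have [T TF] : exists T, forall p, digit T p = F p.
  pose B := \max_(x < L) \max_(y < L) pt c (m + x) (m + y).
  apply: (@digit_table F (tab K + B).+1) => [p|p hp]; rewrite /F.
    case: ifP => _; first by rewrite ltn_mod.
    case: pselect => // e; have [] := bnd (projT1 (cid e)).1 (projT1 (cid e)).2.
    by move=> h1 h2; have [] := entK (nG (projT1 (cid e)).1 (projT1 (cid e)).2) h1 h2.
  rewrite digit_small ?eqxx /=; last by lia.
  case: pselect => // e; have [[x y] [/= xL yL E]] := e.
  have := @leq_bigmax _ (fun y : 'I_L => pt c (m + x) (m + y)) (Ordinal yL).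
  have := @leq_bigmax _ (fun x : 'I_L => \max_(y < L) pt c (m + x) (m + y)) (Ordinal xL).
  by rewrite /= E -/B; lia.
exists (npair c (npair L T)).
have cz : corner (npair c (npair L T)) = c by rewrite /corner nfstK.
have sz : side (npair c (npair L T)) = L by rewrite /side nsndK nfstK.
have tz : table (npair c (npair L T)) = T by rewrite /table !nsndK.
have innerE p : (exists2 xy : int * int, p = orb xy.1 xy.2 K &
     (- D%:Z <= xy.1 <= D%:Z)%R && (- D%:Z <= xy.2 <= D%:Z)%R) ->
    inner K (npair c (npair L T)) p.
  case=> -[i j] /= -> h; apply/innerP; rewrite cz sz -/m.
  exists (absz (i + D%:Z)%R), (absz (j + D%:Z)%R); rewrite /L.
  by split; [lia|lia|rewrite cE; congr orb; lia].
rewrite /new_box cz sz tz Xc andTb; apply/and4P; split.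
- by apply: innerE; exists (0, 0)%R; rewrite ?orb0 //=; lia.
- apply/allP => l; rewrite mem_iota add0n => /= lK.
  rewrite entry_history // /separated; case: eqVneq => //= sl.
  have Xl := cornerX lK sl.
  (* A box in the orbit of [K] lies within distance [D], hence in the inner square; a common point
     with the outer square would put any other box into this orbit. *)
  case: (pselect (near l)) => [nl|fl]; apply/orP; [left|right]; apply/all_outerP => p.
    case/outerP=> x [y [xw yw]]; rewrite (boxE l _ _ Xl (offE l nl)) => <-.
    apply: innerE; exists (al l + x%:Z, be l + y%:Z)%R => //=.
    by have := DP l lK; lia.
  case/outerP=> x [y [xw yw]]; rewrite ptE // => <-.
  apply/negP => /outerP[x' [y' [_ _]]]; rewrite cz ptE // orbD // => E.
  case: fl; have := congr1 (orb (- x%:Z)%R (- y%:Z)%R) E.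
  by rewrite !orbD // !GRing.addNr orb0 // /near => <-; do 2 eexists.
- apply/allP => p _; rewrite /extends tz TF.
  have -> : last_table (history K) = tab K by [].
  rewrite /F; case: ifP => [_|_]; rewrite ?eqxx ?implybT //=.
  case: pselect => [e|//]; have [[x y] [xL yL E]] := e; apply/implyP => _.
  by apply/innerP; exists x, y; rewrite cz sz.
apply/allP => x; rewrite mem_iota leq0n add0n andTb => xL.
apply/allP => y; rewrite mem_iota leq0n add0n andTb => yL.
have cellE' x' y' : x' < L -> y' < L ->
    cell K (npair c (npair L T)) x' y' = lab x' y'.
  by move=> ? ?; rewrite /cell cz sz tz TF F_at.
have labE x' y' : [/\ entW (lab x' y') = nW x' y', entS (lab x' y') = nS x' y' &
    entG (lab x' y') = nG x' y'].
  by have [h1 h2] := bnd x' y'; have [_ -> -> ->] := entK (nG x' y') h1 h2.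
rewrite /cell_ok sz cellE' //; have [-> -> ->] := labE x y.
apply/and3P; split=> //.
- by apply/implyP => /eqP ->; rewrite bot0.
have := flow x y xL yL.
have [? ? ?] := labE x.+1 y; have [_ ? _] := labE x y.+1.
case: ltnP => xL'; case: ltnP => yL'; rewrite ?andTb ?andFb.
- by rewrite (cellE' x.+1 y) // (cellE' x y.+1) //; congr (_ <= _); congruence.
- by rewrite (cellE' x.+1 y) //; congr (_ <= _); congruence.
- by rewrite (cellE' x y.+1) //; congr (_ <= _); congruence.
- by [].
Qed.

End Extension.

Lemma stage_okP k : stage_ok k (history k) (box k).
Proof.
elim/ltn_ind: k => k IH; rewrite /box /choose_box.
case: pselect => [e|[]]; first by case: (ex_minnP e).
rewrite /stage_ok; case: (boolP (_ && _)) => [/andP[Xk /eqP h]|_].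
  exact: new_box_exists.
by exists (npair 0 (npair 0 (last_table (history k)))).
Qed.

(** A point [p] of [X] is labelled at stage [p] at the latest, and labels are permanent, so this is
    the final value. *)
Definition label p := digit (tab p.+1) p.

Lemma label_late k p : X p -> p < k -> label p != 0 /\ digit (tab k) p = label p.
Proof.
move=> Xp pk; have nz : label p != 0.
  rewrite /label tabS; have := stage_okP p; rewrite /stage_ok Xp /=.
  case: eqVneq => [_|h /eqP ->]; last by rewrite /table !nsndK.
  case/and5P => _ /innerP[x [y [xs ys E]]] _ _ /allP/(_ x); rewrite mem_iota.
  move=> /(_ xs)/allP/(_ y); rewrite mem_iota => /(_ ys)/and3P[+ _ _].
  by rewrite /cell E.
by split=> //; apply: (@tab_persist k) => // [j _|]; [apply: stage_okP|rewrite pk leqnn].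
Qed.

(** Wait until [p] and its two neighbours are labelled and take the active box around [p]. The
    neighbours lie at least in its margin; being labelled, they belong to an active box, which by
    disjointness is the same one. So [p] is not on the north or east edge, and [cell_ok] compares
    true labels. *)
Lemma label_flow p : X p ->
  entW (label p) + entS (label p) + (entG (label p) == entG (label (a1 p))) <=
  entW (label (a1 p)) + entS (label (a2 p)).
Proof.
move=> Xp; set q := a1 p; set r := a2 p.
have Xq : X q by rewrite /q a1E ?orbX.
have Xr : X r by rewrite /r a2E ?orbX.
have [K [pK qK rK]] : exists K, [/\ p < K, q < K & r < K].
  by exists (p + q + r).+1; split; lia.
have ok k : k < K -> stage_ok k (history k) (box k) by move=> _; apply: stage_okP.
have [pn pE] := @label_late K p Xp pK.
have [qn qE] := @label_late K q Xq qK.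
have [rn rE] := @label_late K r Xr rK.
have [l al il] := active_cover ok (eq_ind_r (fun d => d != 0) pn pE).
have [x [y [xs ys pxy]]] := innerP _ _ _ il.
have /and3P[lK sl _] := al; have /and5P[Xc _ _ _ /allP cells] := box_ok ok lK sl.
have cells' x' y' : x' < side (box l) -> y' < side (box l) -> cell_ok l (box l) x' y'.
  by move=> hx hy; apply: (allP (cells x' _)); rewrite mem_iota.
have inE s : digit (tab K) s != 0 -> outer l (box l) s -> inner l (box l) s.
  move=> /(active_cover ok)[l' al' il'] ol.
  by rewrite (active_disjoint al al' ol (inner_outer il')).
have cellE' x' y' : x' < side (box l) -> y' < side (box l) ->
    cell l (box l) x' y' = digit (tab K)
      (pt (corner (box l)) (margin l (side (box l)) + x') (margin l (side (box l)) + y')).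
  move=> hx hy; have /and3P[nz _ _] := cells' _ _ hx hy.
  by rewrite cellE in nz *; rewrite -(tab_persist ok (k := l.+1) (k' := K)) // lK leqnn.
have mg : 0 < margin l (side (box l)) by rewrite /margin muln_gt0 expn_gt0; lia.
have qxy : pt (corner (box l)) (margin l (side (box l)) + x.+1) (margin l (side (box l)) + y) = q.
  by rewrite /q -pxy a1E ?ptE ?orbX // orbD //; congr orb; lia.
have rxy : pt (corner (box l)) (margin l (side (box l)) + x) (margin l (side (box l)) + y.+1) = r.
  by rewrite /r -pxy a2E ?ptE ?orbX // orbD //; congr orb; lia.
have xs' : x.+1 < side (box l).
  have /innerP[x' [y' [hx hy]]] : inner l (box l) q.
    apply: inE; first by rewrite qE.
    apply/outerP; exists (margin l (side (box l)) + x.+1), (margin l (side (box l)) + y).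
    by rewrite /width; split=> //; lia.
  by rewrite -qxy !ptE // => /(orb_inj Xc)[]; lia.
have ys' : y.+1 < side (box l).
  have /innerP[x' [y' [hx hy]]] : inner l (box l) r.
    apply: inE; first by rewrite rE.
    apply/outerP; exists (margin l (side (box l)) + x), (margin l (side (box l)) + y.+1).
    by rewrite /width; split=> //; lia.
  by rewrite -rxy !ptE // => /(orb_inj Xc)[]; lia.
have /and3P[_ _] := cells' x y xs ys.
by rewrite xs' ys' !cellE' // pxy qxy rxy pE qE rE.
Qed.

End Strategy.

(** * A program for the strategy *)

Section BoundedSearch.
Variable n : nat.
Implicit Types a b c : ctx n -> nat.

Lemma computable_iter (f : nat -> nat) a b : computable (fun g : ctx 1 => f g.2) ->
  computable a -> computable b -> computable (fun g => iter (b g) f (a g)).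
Proof.
move=> hf ha hb; apply: (@eq_computable _ (fun g => iteri (b g) (fun _ => f) (a g))).
  by move=> g; elim: (b g) => //= k ->.
by apply: computable_iteri => //; apply: computable_app1 hf _; computable_var.
Qed.

(** The accumulator keeps pace with the loop index until [P] first holds and is constant
    afterwards. *)
Lemma computable_find (P : ctx n -> nat -> bool) b :
  computable b -> computableb (fun p : ctx n.+1 => P p.1 p.2) ->
  computable (fun g => find (P g) (iota 0 (b g))).
Proof.
move=> hb hP.
apply: (@eq_computable _ (fun g => iteri (b g)
    (fun i h => h + ((h == i) && ~~ P g i)) 0)).
  move=> g; elim: (b g) => [//|k IH].
  rewrite [LHS]/= IH -addn1 iotaD find_cat size_iota add0n.
  case: (boolP (has _ _)) => h /=.
    have : find (P g) (iota 0 k) < k by rewrite -[X in _ < X](size_iota 0) -has_find.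
    by case: eqP => [->|_]; rewrite ?ltnn ?addn0.
  by rewrite hasNfind // size_iota eqxx; case: (P g k).
apply: computable_iteri => //; first exact: computable_const.
apply: computable_add; first by computable_var.
apply: computableb_and; first by apply: computableb_eq; computable_var.
apply: computableb_neg.
apply: (@computable_comp n.+2 n.+1 _ (fun p => (p.1.1, p.2)) hP); split => /=.
  by have [[]] := computable_ctx_id n.+2.
by computable_var.
Qed.

End BoundedSearch.

Section Division.
Variable n : nat.
Implicit Types a b c : ctx n -> nat.

Lemma computable_div a b :
  computable a -> computable b -> computable (fun g => a g %/ b g).
Proof.
move=> ha hb; pose f x y := if y == 0 then 0 else find (fun q => x < q.+1 * y) (iota 0 x.+1).
apply: (@eq_computable _ (fun g => f (a g) (b g))).
  move=> g; rewrite /f; case: eqVneq => [->|y0]; first by rewrite divn0.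
  move: (a g) (b g) y0 => x y y0; rewrite -lt0n in y0.
  have H q : (x < q.+1 * y) = (x %/ y <= q) by rewrite -ltn_divLR // ltnS.
  have h : has (fun q => x < q.+1 * y) (iota 0 x.+1).
    by apply/hasP; exists (x %/ y); rewrite ?H // mem_iota ltnS leq_div.
  have lt : find (fun q => x < q.+1 * y) (iota 0 x.+1) < x.+1.
    by rewrite -[X in _ < X](size_iota 0) -has_find.
  apply/eqP; rewrite eqn_leq; apply/andP; split.
    rewrite leqNgt; apply/negP => hlt.
    have := before_find 0 hlt; rewrite nth_iota ?add0n ?H ?leqnn //.
    by rewrite ltnS leq_div.
  by have := nth_find 0 h; rewrite nth_iota // add0n H.
apply: (@computable_app2 _ f) => //; rewrite /f.
apply: computable_if; [|exact: computable_const|].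
  by apply: computableb_eq; [computable_var|exact: computable_const].
apply: computable_find; first by apply: computable_S; computable_var.
apply: computableb_leq; first by apply: computable_S; computable_var.
by apply: computable_mul; [apply: computable_S|]; computable_var.
Qed.

Lemma computable_mod a b :
  computable a -> computable b -> computable (fun g => a g %% b g).
Proof.
move=> ha hb; apply: (@eq_computable _ (fun g => a g - a g %/ b g * b g)).
  by move=> g; rewrite {1}(divn_eq (a g) (b g)) addKn.
by apply: computable_sub => //; apply: computable_mul => //; apply: computable_div.
Qed.

End Division.

Ltac solve_arith :=
  lazymatch goal with
  | |- computable (fun g => nat_of_bool (@?P g)) => change (computableb P); cbv beta
  | |- computableb (fun g => ~~ _) => apply: computableb_neg
  | |- computableb (fun g => _ && _) => apply: computableb_and
  | |- computableb (fun g => _ || _) => apply: computableb_or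
  | |- computableb (fun g => _ ==> _) => apply: computableb_imp
  | |- computableb (fun g => _ <= _) => apply: computableb_leq
  | |- computableb (fun g => _ == _) => first [apply: computableb_eq | apply: computableb_eqb]
  | |- computableb (fun g => all _ _) => apply: computableb_all
  | |- computableb (fun g => has _ _) => apply: computableb_has
  | |- computable (fun g => if _ then _ else _) => apply: computable_if
  | |- computable (fun g => find _ _) => apply: computable_find
  | |- computable (fun g => _.+1) => first [exact: computable_const | apply: computable_S]
  | |- computable (fun g => _ + _) => apply: computable_add
  | |- computable (fun g => _ * _) => apply: computable_mul
  | |- computable (fun g => _.-1) => apply: computable_pred
  | |- computable (fun g => _ - _) => apply: computable_sub
  | |- computable (fun g => _ ^ _) => apply: computable_exp
  | |- computable (fun g => _ %/ _) => apply: computable_div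
  | |- computable (fun g => _ %% _) => apply: computable_mod
  | |- computable (fun g => 0) => exact: computable_const
  | |- computable (fun g => snd _) => computable_var
  | |- computable (@snd _ _) => computable_var
  end.

Section Codes.
Variable n : nat.
Implicit Types a b : ctx n -> nat.

Lemma computable_npair a b :
  computable a -> computable b -> computable (fun g => npair (a g) (b g)).
Proof. by apply: computable_app2; rewrite /npair; do !solve_arith. Qed.

Lemma computable_nfst a : computable a -> computable (fun g => nfst (a g)).
Proof. by apply: computable_app1; rewrite /nfst /npair; do !solve_arith. Qed.

Lemma computable_nsnd a : computable a -> computable (fun g => nsnd (a g)).
Proof. by apply: computable_app1; rewrite /nsnd /npair; do !solve_arith. Qed.

Lemma computable_digit a b :
  computable a -> computable b -> computable (fun g => digit (a g) (b g)).
Proof. by apply: computable_app2; rewrite /digit; do !solve_arith. Qed.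

Lemma computable_margin a b :
  computable a -> computable b -> computable (fun g => margin (a g) (b g)).
Proof. by apply: computable_app2; rewrite /margin; do !solve_arith. Qed.

Lemma computable_entW a : computable a -> computable (fun g => entW (a g)).
Proof. by apply: computable_app1; rewrite /entW; do !solve_arith. Qed.

Lemma computable_entS a : computable a -> computable (fun g => entS (a g)).
Proof. by apply: computable_app1; rewrite /entS; do !solve_arith. Qed.

Lemma computable_entG a : computable a -> computableb (fun g => entG (a g)).
Proof.
apply: (@computable_app1 _ (fun d => nat_of_bool (entG d))).
apply: (@eq_computable _ (fun g : ctx 1 => g.2.-1 %% 2)) => [g|];
  [by rewrite modn2|by do !solve_arith].
Qed.

End Codes.

Section StrategyProgram.
Variables (X : pred nat) (a1 a2 : nat -> nat).
Hypothesis computable_predX : computableb (fun g : ctx 1 => X g.2).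
Hypothesis computable_a1 : computable (fun g : ctx 1 => a1 g.2).
Hypothesis computable_a2 : computable (fun g : ctx 1 => a2 g.2).

Section Geometry.
Variable n : nat.
Implicit Types a b c d e : ctx n -> nat.

Lemma computable_pt a b c : computable a -> computable b -> computable c ->
  computable (fun g => pt a1 a2 (a g) (b g) (c g)).
Proof. by move=> *; do 2 apply: computable_iter => //. Qed.

Lemma computable_corner a : computable a -> computable (fun g => corner (a g)).
Proof. exact: computable_nfst. Qed.

Lemma computable_side a : computable a -> computable (fun g => side (a g)).
Proof. by move=> ?; apply/computable_nfst/computable_nsnd. Qed.

Lemma computable_table a : computable a -> computable (fun g => table (a g)).
Proof. by move=> ?; apply/computable_nsnd/computable_nsnd. Qed.

Lemma computable_width a b :
  computable a -> computable b -> computable (fun g => width (a g) (b g)).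
Proof.
move=> ? ?; apply: computable_add; first exact: computable_side.
by do !solve_arith; apply: computable_margin => //; apply: computable_side.
Qed.

Lemma computableb_X a : computable a -> computableb (fun g => X (a g)).
Proof. exact: (@computable_app1 n (fun p => nat_of_bool (X p))). Qed.

End Geometry.

Ltac solve_geom :=
  lazymatch goal with
  | |- computableb (fun g => X _) => apply: computableb_X
  | |- computable (fun g => pt _ _ _ _ _) => apply: computable_pt
  | |- computable (fun g => corner _) => apply: computable_corner
  | |- computable (fun g => side _) => apply: computable_side
  | |- computable (fun g => table _) => apply: computable_table
  | |- computable (fun g => width _ _) => apply: computable_width
  | |- computable (fun g => margin _ _) => apply: computable_margin
  | |- computable (fun g => digit _ _) => apply: computable_digit
  | |- computable (fun g => entW _) => apply: computable_entW
  | |- computable (fun g => entS _) => apply: computable_entS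
  | |- computableb (fun g => entG _) => apply: computable_entG
  | |- computable (fun g => nfst _) => apply: computable_nfst
  | |- computable (fun g => nsnd _) => apply: computable_nsnd
  | |- computable (fun g => npair _ _) => apply: computable_npair
  | |- _ => solve_arith
  end.

Lemma computableb_inner n (a b c : ctx n -> nat) :
  computable a -> computable b -> computable c ->
  computableb (fun g => inner a1 a2 (a g) (b g) (c g)).
Proof.
apply: (@computable_app3 n (fun k z p => nat_of_bool (inner a1 a2 k z p))).
by rewrite /inner; do !solve_geom.
Qed.

Lemma computableb_outer n (a b c : ctx n -> nat) :
  computable a -> computable b -> computable c ->
  computableb (fun g => outer a1 a2 (a g) (b g) (c g)).
Proof.
apply: (@computable_app3 n (fun k z p => nat_of_bool (outer a1 a2 k z p))).
by rewrite /outer; do !solve_geom.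
Qed.

Lemma computable_cell n (a b c d : ctx n -> nat) :
  computable a -> computable b -> computable c -> computable d ->
  computable (fun g => cell a1 a2 (a g) (b g) (c g) (d g)).
Proof. by move=> *; rewrite /cell; do !solve_geom. Qed.

Ltac solve_boxes :=
  lazymatch goal with
  | |- computableb (fun g => inner _ _ _ _ _) => apply: computableb_inner
  | |- computableb (fun g => outer _ _ _ _ _) => apply: computableb_outer
  | |- computable (fun g => cell _ _ _ _ _ _) => apply: computable_cell
  | |- _ => solve_geom
  end.

Lemma computableb_cell_ok n (a b c d : ctx n -> nat) :
  computable a -> computable b -> computable c -> computable d ->
  computableb (fun g => cell_ok a1 a2 (a g) (b g) (c g) (d g)).
Proof.
apply: (@computable_app4 n (fun k z x y => nat_of_bool (cell_ok a1 a2 k z x y))).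
by rewrite /cell_ok; do !solve_boxes.
Qed.

Lemma computableb_extends n (a b c d : ctx n -> nat) :
  computable a -> computable b -> computable c -> computable d ->
  computableb (fun g => extends a1 a2 (a g) (b g) (c g) (d g)).
Proof.
apply: (@computable_app4 n (fun k z x y => nat_of_bool (extends a1 a2 k z x y))).
by rewrite /extends; do !solve_boxes.
Qed.

Lemma computableb_separated n (a b c d : ctx n -> nat) :
  computable a -> computable b -> computable c -> computable d ->
  computableb (fun g => separated a1 a2 (a g) (b g) (c g) (d g)).
Proof.
apply: (@computable_app4 n (fun k z x y => nat_of_bool (separated a1 a2 k z x y))).
rewrite /separated /all_outer.
by do !solve_boxes.
Qed.

Lemma computable_entry n (a b c : ctx n -> nat) :
  computable a -> computable b -> computable c ->
  computable (fun g => entry (a g) (b g) (c g)).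
Proof.
apply: (@computable_app3 n entry); rewrite /entry.
by apply: computable_nfst; apply: computable_iter; [apply: computable_nsnd|..]; do !solve_arith.
Qed.

Lemma computable_last_table n (a : ctx n -> nat) :
  computable a -> computable (fun g => last_table (a g)).
Proof. by move=> ?; apply/computable_table/computable_nfst. Qed.

Ltac solve_stage :=
  lazymatch goal with
  | |- computableb (fun g => separated _ _ _ _ _ _) => apply: computableb_separated
  | |- computable (fun g => entry _ _ _) => apply: computable_entry
  | |- computableb (fun g => extends _ _ _ _ _ _) => apply: computableb_extends
  | |- computable (fun g => last_table _) => apply: computable_last_table
  | |- computableb (fun g => cell_ok _ _ _ _ _ _) => apply: computableb_cell_ok
  | |- _ => solve_boxes
  end.

Lemma computableb_new_box n (a b c : ctx n -> nat) :
  computable a -> computable b -> computable c ->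
  computableb (fun g => new_box X a1 a2 (a g) (b g) (c g)).
Proof.
apply: (@computable_app3 n (fun k z p => nat_of_bool (new_box X a1 a2 k z p))).
by rewrite /new_box; do !solve_stage.
Qed.

Lemma computableb_stage_ok n (a b c : ctx n -> nat) :
  computable a -> computable b -> computable c ->
  computableb (fun g => stage_ok X a1 a2 (a g) (b g) (c g)).
Proof.
move=> ha hb hc; pose P k s := X k && (digit (last_table s) k == 0).
have hP : computableb (fun g => P (a g) (b g)).
  by rewrite /P; do !solve_stage.
pose Q k s z := P k s && new_box X a1 a2 k s z
  || ~~ P k s && (z == npair 0 (npair 0 (last_table s))).
apply: (@eq_computable _ (fun g => nat_of_bool (Q (a g) (b g) (c g)))).
  by move=> g; rewrite /Q /stage_ok -/(P _ _); case: (P _ _); rewrite /= ?orbF.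
apply: computableb_or; apply: computableb_and => //; first exact: computableb_new_box.
  exact: computableb_neg.
by do !solve_stage.
Qed.

Local Notation history := (history X a1 a2).

Hypothesis okP : forall k, stage_ok X a1 a2 k (history k) (box X a1 a2 k).

(** The only unbounded search of the strategy: it halts by [okP], and minimality identifies its
    result with [box k]. *)
Lemma computable_history n (a : ctx n -> nat) :
  computable a -> computable (fun g => history (a g)).
Proof.
apply: computable_app1.
have [test testP] : computable (fun g : ctx 3 => ~~ stage_ok X a1 a2 g.1.2 g.1.1.2 g.2).
  by apply: computableb_neg; apply: computableb_stage_ok; computable_var.
have [mkpair pairP] : computable (fun g : ctx 2 => npair g.2 g.1.2).
  by apply: computable_npair; computable_var.
exists (RPrec RZero (RComp mkpair (fun i : 'I_2 =>
   if i == ord0 then RMin test else RProj ord_max))) => g /=.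
exists history; split=> // k _.
set v := [tuple of k :: _].
exists [tuple box X a1 a2 k; history k]; last first.
  have := pairP (tt, history k, box X a1 a2 k).
  by congr (recfun_eval mkpair _ _); apply: val_inj.
have testE y : recfun_eval test [tuple of y :: v] (~~ stage_ok X a1 a2 k (history k) y).
  have := testP (tt, history k, k, y).
  by congr (recfun_eval test _ _); apply: val_inj.
move=> i; case: (unliftP ord0 i) => [j ->|->] /=; last first.
  have := testE (box X a1 a2 k); rewrite okP => h; split=> // y yb; exists 0.
  have := testE y; rewrite (_ : stage_ok _ _ _ _ _ y = false) //.
  apply/negP => hy; move: yb; rewrite /box /choose_box.
  case: pselect => [e|[]]; last by exists y.
  by case: (ex_minnP e) => m _ /(_ y hy); rewrite ltnNge => ->.
by rewrite (ord1 j) /v; rewrite !(tnth_nth 0).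
Qed.

(** A finite lookup table. It allows the numbering of the labels to be an arbitrary function. *)
Lemma computable_finite n (F : nat -> nat) N (a : ctx n -> nat) :
  (forall g, a g < N) -> computable a -> computable (fun g => F (a g)).
Proof.
move=> aN ha; pose f := fix f N d := if N is N'.+1 then if d == N' then F N' else f N' d else 0.
have fE M d : d < M -> f M d = F d.
  by elim: M => //= M IH; rewrite ltnS leq_eqVlt; case: eqP => [->|_ /IH].
apply: (@eq_computable _ (fun g => f N (a g))) => [g|]; first exact: fE.
elim: N {aN fE} => [|N IH]; first exact: computable_const.
by apply: computable_if => //; [apply: computableb_eq => //|]; apply: computable_const.
Qed.

Lemma label_program (F : nat -> nat) :
  exists c : recfun 1, forall p, recfun_eval c [tuple p] (F (label X a1 a2 p)).
Proof.
have [c cP] : computable (fun g : ctx 1 => F (label X a1 a2 g.2)).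
  apply: (@computable_finite _ _ 51) => [g|]; first by rewrite ltn_mod.
  apply: computable_digit; last by computable_var.
  by apply/computable_last_table/computable_history/computable_S; computable_var.
exists c => p; have := cP (tt, p).
by congr (recfun_eval c _ _); apply: val_inj.
Qed.

End StrategyProgram.

Import Order.TTheory GRing.Theory Num.Theory.

(** * The 3-adic odometer *)

Local Open Scope classical_set_scope.

Section Reduction.
Variable n : nat.
Local Open Scope ring_scope.
Implicit Types u v : 'rV[int]_n.

Definition residue k v : 'rV[int]_n := map_mx (fun z => (z %% (3 ^ k)%N%:Z)%Z) v.

Lemma residue_residue k l v : (k <= l)%N -> residue k (residue l v) = residue k v.
Proof.
move=> kl; apply/rowP => i; rewrite !mxE.
rewrite [in RHS](divz_eq (v 0 i) (3 ^ l)%N) -{3}(subnK kl) expnD PoszM mulrA.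
by rewrite modzMDl.
Qed.

Lemma residueDr k u v : residue k (u + residue k v) = residue k (u + v).
Proof. by apply/rowP => i; rewrite !mxE modzDmr. Qed.

Lemma residue_period k u v : residue k (u + v *+ (3 ^ k)) = residue k u.
Proof.
apply/rowP => i; rewrite !mxE mulmxnE -mulr_natr addrC.
by rewrite (_ : ((3 ^ k)%:R : int) = (3 ^ k)%N%:Z) ?modzMDl // natz.
Qed.

Lemma residue_free k u v : residue k (u + v) = residue k v -> forall i, (3 ^ k %| `|u 0%R i|)%N.
Proof.
move=> /rowP h i; have := h i; rewrite !mxE => /eqP.
by rewrite -[X in _ == (X %% _)%Z]add0r eqz_modDr eqz_mod_dvd subr0.
Qed.

End Reduction.

(** The inverse limit of the groups of vectors modulo [3 ^ k], each class given by its reduced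
    representative. *)
Record odometer (n : nat) := Odometer {
  coords :> nat -> 'rV[int]_n;
  coords_coherent : forall k, coords k = residue k (coords k.+1) }.

HB.instance Definition _ n := gen_eqMixin (odometer n).
HB.instance Definition _ n := gen_choiceMixin (odometer n).

Section Odometer.
Variable n : nat.
Implicit Types (x y z : odometer n) (v w : 'rV[int]_n).
Local Open Scope ring_scope.

Lemma odometer_eq x y : (forall k, x k = y k) -> x = y.
Proof.
case: x y => [x xP] [y yP] /= /funext xy; subst y.
by congr Odometer; apply: Prop_irrelevance.
Qed.

Lemma coords_le x k l : (k <= l)%N -> x k = residue k (x l).
Proof.
have fix_coords j : x j = residue j (x j).
  by rewrite [LHS]coords_coherent [in RHS]coords_coherent residue_residue.
elim: l => [|l IH]; first by rewrite leqn0 => /eqP ->.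
rewrite leq_eqVlt => /predU1P[-> //|].
by rewrite ltnS => kl; rewrite (IH kl) coords_coherent residue_residue.
Qed.

Lemma residue_coords x k : residue k (x k) = x k.
Proof. by rewrite -coords_le. Qed.

Lemma agree_le x y k l : (k <= l)%N -> x l = y l -> x k = y k.
Proof. by move=> kl xy; rewrite (coords_le x kl) xy -coords_le. Qed.

Definition cylinder x k : set (odometer n) := [set y : odometer n | y k = x k].

Definition odometer_nbhs x := filter_from setT (cylinder x).

HB.instance Definition _ := hasNbhs.Build (odometer n) odometer_nbhs.

Lemma odometer_nbhsE x (A : set (odometer n)) :
  nbhs x A <-> exists k, cylinder x k `<=` A.
Proof. by split => [[k _ h]|[k h]]; exists k. Qed.

Lemma odometer_nbhs_filter x : ProperFilter (nbhs x).
Proof.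
apply: filter_from_proper; last by move=> k _; exists x.
apply: filter_from_filter; first by exists 0%N.
move=> k l _ _; exists (maxn k l) => // y h.
by split; apply: agree_le h; rewrite ?leq_maxl ?leq_maxr.
Qed.

Lemma odometer_nbhs_singleton x (A : set (odometer n)) : nbhs x A -> A x.
Proof. by case/odometer_nbhsE => k; apply. Qed.

Lemma odometer_nbhs_nbhs x (A : set (odometer n)) : nbhs x A -> nbhs x (nbhs^~ A).
Proof.
case/odometer_nbhsE => k h; apply/odometer_nbhsE; exists k => y xy.
by apply/odometer_nbhsE; exists k => z yz; apply: h; rewrite /cylinder /= yz xy.
Qed.

HB.instance Definition _ := Nbhs_isNbhsTopological.Build (odometer n)
  odometer_nbhs_filter odometer_nbhs_singleton odometer_nbhs_nbhs.

Definition translate v x : odometer n.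
Proof.
exists (fun k => residue k (v + x k)) => k.
by rewrite residue_residue // (coords_coherent x k) residueDr.
Defined.

Lemma translate_action : @is_action (Zpow n) (odometer n) translate.
Proof.
split=> [x|g h x]; apply: odometer_eq => k /=.
  by rewrite (_ : (1%g : Zpow n) = (0 : 'rV[int]_n)) // add0r residue_coords.
by rewrite residueDr addrA.
Qed.

Lemma translate_free : @free_action (Zpow n) (odometer n) translate.
Proof.
split=> [|g x g1 gx]; first exact: translate_action.
apply: g1; apply/rowP => i; rewrite mxE.
have h k : (3 ^ k %| `|(g : 'rV[int]_n) 0%R i|)%N.
  by apply: (@residue_free _ _ _ (x k)); rewrite residue_coords -[in RHS]gx.
set z := (g : 'rV[int]_n) 0%R i in h *; apply/eqP; rewrite -absz_eq0.
case: posnP => // z0; have := dvdn_leq z0 (h `|z|%N).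
by rewrite leqNgt ltn_expl.
Qed.

Lemma translate_open v (A : set (odometer n)) : open A -> open (translate v @^-1` A).
Proof.
rewrite !openE => Ao x /Ao/odometer_nbhsE[k h]; apply/odometer_nbhsE; exists k => y yx.
by apply: h; rewrite /cylinder /= yx.
Qed.

Lemma translate_borel : @borel_action (Zpow n) (odometer n) translate.
Proof.
move=> v B bB; apply: (bB [set B | (<<s @open (odometer n) >>) (translate v @^-1` B)]).
split; last by move=> A /(@translate_open v) Ao; apply: sub_gen_smallest.
have [h0 hC hU] := smallest_sigma_algebra setT (@open (odometer n)).
split=> /= [|A|F]; first by rewrite preimage_set0.
  by move=> hA; rewrite setTD preimage_setC -setTD; apply: hC.
by move=> hF; rewrite preimage_bigcup; apply: hU.
Qed.

Lemma residue0 k : (0 : 'rV[int]_n) = residue k 0.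
Proof. by apply/rowP => i; rewrite !mxE mod0z. Qed.

Definition zero := Odometer residue0.

(** * The odometer is Polish *)

Section Metric.
Variable R : realType.

Definition inv_first (P : pred nat) : R :=
  if pselect (exists k, P k) is left e then (ex_minn e).+1%:R^-1 else 0.

Definition odometer_dist x y := inv_first (fun k => x k != y k).

(** The balls of radius [k.+1%:R^-1] are thus the cylinders of level [k], so metric questions become
    questions about coordinates. *)
Lemma odometer_dist_lt x y k : (odometer_dist x y < k.+1%:R^-1) = (x k == y k).
Proof.
rewrite /odometer_dist /inv_first; case: pselect => [e|ne].
  case: (ex_minnP e) => m xym mmin; rewrite ltf_pV2 ?posrE ?ltr0n // ltr_nat ltnS.
  apply/idP/eqP => [km|xyk].
    by apply/eqP/negPn/negP => /mmin; rewrite leqNgt km.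
  by rewrite ltnNge; apply/negP => mk; move: xym; rewrite (agree_le mk xyk) eqxx.
rewrite invr_gt0 ltr0n /=; apply/esym/eqP; apply: contrapT => h.
by apply: ne; exists k; apply/eqP.
Qed.

Lemma odometer_dist_range x y : 0 <= odometer_dist x y /\
  (odometer_dist x y = 0 -> x = y).
Proof.
rewrite /odometer_dist /inv_first; case: pselect => [e|ne].
  split; first by rewrite invr_ge0 ler0n.
  by move/eqP; rewrite invr_eq0 pnatr_eq0.
split=> // _; apply: odometer_eq => k; apply: contrapT => h.
by apply: ne; exists k; apply/eqP.
Qed.

Lemma odometer_metric : is_metric odometer_dist.
Proof.
split=> [x y|x y|x y|x y z].
- by case: (odometer_dist_range x y).
- split; first by case: (odometer_dist_range x y).
  move=> ->; rewrite /odometer_dist /inv_first; case: pselect => // e.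
  by exfalso; case: e => k; rewrite eqxx.
- rewrite /odometer_dist (_ : (fun k => x k != y k) = (fun k => y k != x k)) //.
  by apply: funext => k; rewrite eq_sym.
- rewrite {1}/odometer_dist /inv_first; case: pselect => [e|_]; last first.
    by apply: addr_ge0; [case: (odometer_dist_range x y)|case: (odometer_dist_range y z)].
  case: (ex_minnP e) => m xzm _.
  have [xym|xym] := eqVneq (x m) (y m).
    rewrite -[leLHS]add0r lerD //; first by case: (odometer_dist_range x y).
    by rewrite leNgt odometer_dist_lt -xym.
  rewrite -[leLHS]addr0 lerD //; last by case: (odometer_dist_range y z).
  by rewrite leNgt odometer_dist_lt.
Qed.

Lemma odometer_polish : polish R (odometer n).
Proof.
split.
  exists (range (fun v => translate v zero)); split.
    by apply: sub_countable (card_image_le _ _) _; apply: countableP.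
  move=> O [x Ox]; rewrite openE => /(_ x Ox)/odometer_nbhsE[k h].
  exists (translate (x k) zero); split; last by exists (x k).
  by apply: h; rewrite /cylinder /= addr0 residue_coords.
exists odometer_dist; split; first exact: odometer_metric.
  move=> x; apply/funext => A; apply/propext; split.
    case/odometer_nbhsE => k h; exists k.+1%:R^-1; first by rewrite /= invr_gt0.
    by move=> y /=; rewrite odometer_dist_lt => /eqP xy; apply: h.
  case=> e /= e0 h; apply/odometer_nbhsE.
  have [k ke] : exists k, k.+1%:R^-1 < e.
    exists (Num.bound e^-1); rewrite invf_plt ?posrE // (lt_trans (archi_boundP _)) ?ltr_nat //.
    by rewrite invr_ge0 ltW.
  exists k => y yx; apply: h => /=; apply: lt_trans ke.
  by rewrite odometer_dist_lt yx.
move=> u uC.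
(* Each coordinate of a Cauchy sequence is eventually constant. *)
have /choice[N NP] k : exists N, forall m, (N <= m)%N -> u m k = u N k.
  have [|N NP] := uC k.+1%:R^-1; first by rewrite invr_gt0.
  by exists N => m Nm; have := NP m N Nm (leqnn N); rewrite odometer_dist_lt => /eqP.
have lc k : u (N k) k = residue k (u (N k.+1) k.+1).
  rewrite -coords_coherent -(NP k (maxn (N k) (N k.+1))) ?leq_maxl //.
  by apply: (@agree_le _ _ _ k.+1) => //; rewrite NP // leq_maxr.
exists (Odometer lc) => A /odometer_nbhsE[k h].
by exists (N k) => // m /= Nm; apply: h; rewrite /cylinder /= NP.
Qed.

End Metric.

(** * Baire category in the odometer *)

(** The condition [k < l] makes the levels of nested cylinders grow, so that in [odometer_baire]
    they shrink to a single point. *)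
Lemma nowhere_denseP (A : set (odometer n)) : nowhere_dense A <->
  forall x k, exists y l,
    [/\ (k < l)%N, y k = x k & forall z : odometer n, z l = y l -> ~ A z].
Proof.
split=> [nA x k|h].
  have [y yk /existsNP[B /not_implyP[/odometer_nbhsE[l yB] AB]]] :
      exists2 y : odometer n, y k = x k & ~ closure A y.
    apply: contrapT => /forall2NP h; suff: interior (closure A) x by rewrite nA.
    by apply/odometer_nbhsE; exists k => y yx; case: (h y) => // /contrapT.
  exists y, (maxn k.+1 l); split=> //; first by rewrite leq_maxl.
  move=> z zy Az; apply: AB; exists z; split=> //; apply: yB.
  by apply: agree_le zy; rewrite leq_maxr.
rewrite /nowhere_dense -subset0 => x /odometer_nbhsE[k xk].
have [y [l [kl yx yA]]] := h x k.
have : closure A y by apply: xk.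
case/(_ (cylinder y l)); first by apply/odometer_nbhsE; exists l.
by move=> z [Az zy]; apply: (yA z).
Qed.

Lemma odometer_baire (F : nat -> set (odometer n)) :
  (forall i, nowhere_dense (F i)) -> exists x, forall i, ~ F i x.
Proof.
move=> nF.
have next i (p : odometer n * nat) : {q : odometer n * nat |
    [/\ (p.2 < q.2)%N, q.1 p.2 = p.1 p.2 & forall z : odometer n, z q.2 = q.1 q.2 -> ~ F i z]}.
  apply: cid; have /nowhere_denseP/(_ p.1 p.2)[y [l h]] := nF i.
  by exists (y, l).
pose s := fix s i := if i is j.+1 then sval (next j (s j)) else (zero, 0%N).
have sS i : [/\ ((s i).2 < (s i.+1).2)%N, (s i.+1).1 (s i).2 = (s i).1 (s i).2 &
    forall z : odometer n, z (s i.+1).2 = (s i.+1).1 (s i.+1).2 -> ~ F i z].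
  exact: svalP (next i (s i)).
have s_ge i : (i <= (s i).2)%N.
  by elim: i => // i IH; have [lt _ _] := sS i; apply: leq_ltn_trans lt.
have s_le i j : (i <= j)%N -> ((s i).2 <= (s j).2)%N /\ (s j).1 (s i).2 = (s i).1 (s i).2.
  elim: j => [|j IH]; first by rewrite leqn0 => /eqP ->.
  rewrite leq_eqVlt => /predU1P[-> //|]; rewrite ltnS => /IH[le E].
  have [lt E' _] := sS j; split; first exact: leq_trans le (ltnW lt).
  by rewrite -E; apply: agree_le E'.
have lc k : (s k).1 k = residue k ((s k.+1).1 k.+1).
  rewrite -coords_coherent; apply: (@agree_le _ _ _ (s k).2) => //.
  by have [_ ->] := s_le k k.+1 (leqnSn k).
exists (Odometer lc) => i; have [_ _] := sS i; apply => /=.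
set k := (s i.+1).2; have [_ <-] := s_le i.+1 (maxn k i.+1) (leq_maxr _ _).
have h : (k <= maxn k i.+1)%N by rewrite leq_maxl.
by have [le E] := s_le k _ h; apply: esym; apply: agree_le E.
Qed.

Lemma nowhere_dense_translate v (A : set (odometer n)) :
  nowhere_dense A -> nowhere_dense (translate v @^-1` A).
Proof.
have tK w x : translate (- w) (translate w x) = x.
  have [a1 aM] := translate_action; rewrite -(aM (- w) w).
  by rewrite (_ : ((- w : Zpow n) * w)%g = 1%g) //; apply: addNr.
move=> /nowhere_denseP nA; apply/nowhere_denseP => x k.
have [y [l [kl yx yA]]] := nA (translate v x) k.
exists (translate (- v) y), l; split=> // [|z zy].
  by rewrite -[in RHS](tK v x) /= yx.
apply: yA; rewrite /= zy /= residueDr addrA addrN add0r residue_coords.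
by [].
Qed.

(** Each preimage of a label differs from an open set by a meager one. A point whose translates
    avoid these countably many exceptional sets sees only the open sets. An open set contains a
    cylinder around each of its points, and translations by multiples of [3 ^ k] preserve cylinders
    of level [k]. *)
Lemma baire_toeplitz (L : finType) (f : odometer n -> L) : baire_measurable f ->
  exists x, forall v, exists k, forall w,
    f (translate (v + w *+ (3 ^ k)) x) = f (translate v x).
Proof.
move=> fB.
have /choice[U UP] l : exists U : set (odometer n), open U /\
    meager ((f @^-1` [set l]) `+` U) by have [U oU mU] := fB [set l]; exists U.
have /choice[F FP] l : exists F : nat -> set (odometer n),
    (forall i, nowhere_dense (F i)) /\ (f @^-1` [set l]) `+` U l = \bigcup_i F i.
  by have [_ [F nF E]] := UP l; exists F.
pose bad (j : 'rV[int]_n * L * nat) := translate j.1.1 @^-1` F j.1.2 j.2.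
have [x xP] : exists x, forall i, ~ (if choice.unpickle i is Some j then bad j else set0) x.
  apply: odometer_baire => i; case: (choice.unpickle i) => [[[v l] j]|]; last first.
    by rewrite /nowhere_dense closure0 interior0.
  by apply: nowhere_dense_translate; have [nF _] := FP l.
have good v l : f (translate v x) = l <-> U l (translate v x).
  have : ~ ((f @^-1` [set l]) `+` U l) (translate v x).
    have [_ ->] := FP l => -[i _ h]; apply: (xP (choice.pickle (v, l, i))).
    by rewrite choice.pickleK.
  rewrite /setY /= => /not_orP[/not_andP h1 /not_andP h2].
  by split=> h; [case: h1 => // /contrapT|case: h2 => // /contrapT].
exists x => v; have [oU _] := UP (f (translate v x)).
move: oU; rewrite openE => /(_ _ ((good v _).1 erefl))/odometer_nbhsE[k h].
exists k => w; apply/good; apply: h; rewrite /cylinder /=.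
by rewrite addrAC residue_period.
Qed.

End Odometer.

(** * The flow problem *)

(** Summed over the square, the flow through inner edges cancels; all defects are paid for by what
    leaves through the east and north sides. *)
Lemma flux_bound (W S : nat -> nat -> nat) (d : nat -> nat -> bool) b N :
  (forall i j, W i j + S i j + d i j <= W i.+1 j + S i j.+1)%N ->
  (forall i j, W i j <= b /\ S i j <= b)%N ->
  (\sum_(i < N) \sum_(j < N) d i j <= 2 * b * N)%N.
Proof.
move=> flow bnd.
have tele (a : nat -> nat) : (\sum_(i < N) a i.+1 + a 0 = \sum_(i < N) a i + a N)%N.
  by rewrite addnC -(big_ord_recl N (fun i => a i)) big_ord_recr.
have HW : (\sum_(i < N) \sum_(j < N) W i.+1 j <=
           \sum_(i < N) \sum_(j < N) W i j + b * N)%N.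
  rewrite exchange_big [X in (_ <= X + _)%N]exchange_big /=.
  rewrite -[X in (b * X)%N]card_ord mulnC -sum_nat_const -big_split /=.
  by apply: leq_sum => j _; have /= := tele (W ^~ j); have [] := bnd N j; lia.
have HS : (\sum_(i < N) \sum_(j < N) S i j.+1 <=
           \sum_(i < N) \sum_(j < N) S i j + b * N)%N.
  rewrite -[X in (b * X)%N]card_ord mulnC -sum_nat_const -big_split /=.
  by apply: leq_sum => i _; have /= := tele (S i); have [] := bnd i N; lia.
have H : (\sum_(i < N) \sum_(j < N) (W i j + S i j + d i j) <=
          \sum_(i < N) \sum_(j < N) (W i.+1 j + S i j.+1))%N.
  by apply: leq_sum => i _; apply: leq_sum => j _.
have split2 (f g : nat -> nat -> nat) : (\sum_(i < N) \sum_(j < N) (f i j + g i j) =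
    \sum_(i < N) \sum_(j < N) f i j + \sum_(i < N) \sum_(j < N) g i j)%N.
  by rewrite -big_split /=; apply: eq_bigr => i _; rewrite big_split.
move: H; rewrite (split2 (fun i j => W i j + S i j)%N (fun i j => nat_of_bool (d i j))).
by rewrite (split2 W S) (split2 (fun i j => W i.+1 j) (fun i j => S i j.+1)); lia.
Qed.

Lemma sum_multiples (a : nat -> nat) q M : (0 < q)%N ->
  (\sum_(i < M) a (i * q)%N <= \sum_(i < M * q) a i)%N.
Proof.
move=> q0; elim: M => [|M IH]; first by rewrite big_ord0.
rewrite big_ord_recr mulSnr big_split_ord /= leq_add //.
by case: q q0 {IH} => // q _; rewrite big_ord_recl /= addn0 leq_addr.
Qed.

Lemma no_periodic_defect (W S : nat -> nat -> nat) (d : nat -> nat -> bool) b q :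
  (0 < q)%N ->
  (forall i j, W i j + S i j + d i j <= W i.+1 j + S i j.+1)%N ->
  (forall i j, W i j <= b /\ S i j <= b)%N ->
  ~ (forall i j, d (i * q)%N (j * q)%N).
Proof.
(* With this [M] the [M * M] periodic defects exceed the bound [2 * b * (M * q)] on the flux. *)
move=> q0 flow bnd per; pose M := (2 * b * q).+1.
have := flux_bound (M * q) flow bnd.
have : (M * M <= \sum_(i < M * q) \sum_(j < M * q) d i j)%N.
  apply: leq_trans (@sum_multiples
    (fun i => \sum_(j < M * q) d i j)%N q M q0).
  rewrite -{1}(card_ord M) -sum_nat_const; apply: leq_sum => i _.
  apply: leq_trans (@sum_multiples (fun j => nat_of_bool (d (i * q)%N j)) q M q0).
  by rewrite (eq_bigr (fun=> 1%N)) ?sum1_card ?card_ord // => j _; rewrite per.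
by rewrite /M; nia.
Qed.

(** * The local rule *)

Section FlowLCL.
Variables (G : groupType) (g1 g2 : G).

Definition flow_window : {fset G} := [fset 1%g; g1; g2]%fset.

Lemma flow_window0 : 1%g \in flow_window. Proof. by rewrite !inE eqxx. Qed.
Lemma flow_window1 : g1 \in flow_window. Proof. by rewrite !inE eqxx orbT. Qed.
Lemma flow_window2 : g2 \in flow_window. Proof. by rewrite !inE eqxx !orbT. Qed.

Definition flow_label : finType := ('I_5 * 'I_5 * bool)%type.

(* A label records the flow entering from the west, the flow entering from the
   south (shifted by 1 so that -1 is representable), and a colour. *)
Definition flow_rule (l0 l1 l2 : flow_label) :=
  (l0.1.1 + l0.1.2 + (l0.2 == l1.2) <= l1.1.1 + l2.1.2)%N.

Definition flow_lcl : LCL G :=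
  mkLCL [set phi : {ffun flow_window -> flow_label} |
    flow_rule (phi [` flow_window0]%fset) (phi [` flow_window1]%fset)
              (phi [` flow_window2]%fset)].

Lemma flow_lcl_solution (X : Type) (act : G -> X -> X) (f : X -> flow_label) :
  is_action act -> @lcl_solution G flow_lcl X act f <->
  forall x, flow_rule (f x) (f (act g1 x)) (f (act g2 x)).
Proof.
case=> act1 _; split=> h x; have := h x; rewrite inE !ffunE /=; first by rewrite act1.
by rewrite act1.
Qed.

End FlowLCL.

(** * No Baire measurable solution *)

Section NotBaire.
Variables (R : realType) (n : nat) (e1 e2 : 'rV[int]_n).

Lemma flow_lcl_not_baire : ~ BAIRE R (@flow_lcl (Zpow n) e1 e2).
Proof.
move=> /(_ (odometer n) (@translate n) (odometer_polish n R)).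
case/(_ (@translate_free n) (@translate_borel n)) => f [fB].
have [t1 tM] := @translate_action n; move/(flow_lcl_solution _ _ _ (conj t1 tM)) => fsol.
have [x xP] := baire_toeplitz fB.
pose P v := f (translate v x).
have PS v : flow_rule (P v) (P (e1 + v)%R) (P (e2 + v)%R).
  by have := fsol (translate v x); rewrite -!tM.
(* [3 ^ (k + l)] is a common multiple of the two periods; a defect involves two points, which have
   to recur together. *)
have per v w : exists k, forall u, P (v + u *+ (3 ^ k))%R = P v /\ P (w + u *+ (3 ^ k))%R = P w.
  have [k kP] := xP v; have [l lP] := xP w; exists (k + l)%N => u; split.
    by rewrite expnD mulnC mulrnA; apply: kP.
  by rewrite expnD mulrnA; apply: lP.
case: (pselect (exists v, (P v).2 = (P (e1 + v)%R).2)) => [[v vP]|nodef].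
  have [k kP] := per v (e1 + v)%R.
  pose p i j := (v + e1 *+ i + e2 *+ j)%R.
  apply: (@no_periodic_defect (fun i j => (P (p i j)).1.1) (fun i j => (P (p i j)).1.2)
    (fun i j => (P (p i j)).2 == (P (p i.+1 j)).2) 4 (3 ^ k)%N).
  - by rewrite expn_gt0.
  - move=> i j; have := PS (p i j); rewrite /flow_rule.
    have -> : (e1 + p i j = p i.+1 j)%R by rewrite /p mulrS; rewrite !addrA [(e1 + v)%R]addrC.
    have -> // : (e2 + p i j = p i j.+1)%R by rewrite /p [in RHS]mulrS addrCA.
  - by move=> i j; split; rewrite -ltnS ltn_ord.
  move=> i j; have -> : p (i * 3 ^ k)%N (j * 3 ^ k)%N = (v + (e1 *+ i + e2 *+ j) *+ (3 ^ k))%R.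
    by rewrite /p !mulrnA mulrnDl addrA.
  have -> : p (i * 3 ^ k).+1 (j * 3 ^ k)%N = (e1 + v + (e1 *+ i + e2 *+ j) *+ (3 ^ k))%R.
    by rewrite /p mulrS !mulrnA mulrnDl !addrA [(e1 + v)%R]addrC.
  by have [-> ->] := kP (e1 *+ i + e2 *+ j)%R; apply/eqP.
have alt i : (P (e1 *+ i)%R).2 = odd i (+) (P 0%R).2.
  elim: i => [|i IH]; first by rewrite mulr0n.
  rewrite mulrS; have : (P (e1 *+ i)%R).2 <> (P (e1 + e1 *+ i)%R).2.
    by move=> E; apply: nodef; exists (e1 *+ i)%R.
  by rewrite IH /=; case: (odd i); case: (P _).2; case: (P _).2.
have [k /(_ e1)[+ _]] := per 0%R 0%R; rewrite add0r => E.
have := alt (3 ^ k)%N; rewrite E oddX /= orbT /=.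
by case: (P 0%R).2.
Qed.

End NotBaire.

(** * Computable solutions *)

Section Computable.
Variables (n : nat) (e1 e2 : 'rV[int]_n).
Hypothesis indep : forall i j : int, (e1 *~ i + e2 *~ j = 0 -> i = 0 /\ j = 0)%R.

Lemma flow_lcl_computable : COMPUTABLE (@flow_lcl (Zpow n) e1 e2).
Proof.
move=> X act [cX cXP] [act_action act_free] act_comp.
have [act1 actM] := act_action.
(* The search tests arbitrary codes, so the generators must be total; the value 0 outside [X] is a
   dummy. *)
pose app g p := if pselect (p \in X) is left h then val (act g (exist _ p h)) else 0%N.
have appE g (x : X) : app g (val x) = val (act g x).
  rewrite /app; case: pselect => [h|[]]; last exact: (valP x).
  by congr (val (act g _)); apply: val_inj.
have computable_app g : computable (fun c : ctx 1 => app g c.2).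
  have [c cP] := act_comp g.
  have [z zP] : computable (fun c : ctx 1 => 0%N) by exact: computable_const.
  (* Recursion on the truth value of membership in [X] runs [c] only if this value is 1, since [c]
     may diverge outside [X]. *)
  pose guard : recfun 2 := RPrec z (RComp c (fun=> RProj (@ord_max 2))).
  exists (RComp guard (fun i : 'I_2 => if i == ord0 then cX else RProj ord0)) => c1 /=.
  exists [tuple (c1.2 \in X : nat); c1.2] => [i|].
    case: (unliftP ord0 i) => [j ->|->] /=; first by rewrite (ord1 j) !(tnth_nth 0%N).
    by have := cXP c1.2; congr (recfun_eval cX _ _); apply: val_inj.
  exists (fun k => if k is 0%N then 0%N else app g c1.2); split.
  - by have := zP c1; congr (recfun_eval z _ _); apply: val_inj.
  - rewrite /thead (tnth_nth 0%N) /= => k kX.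
    exists [tuple c1.2] => [i|]; first by rewrite (ord1 i) !(tnth_nth 0%N).
    have h : c1.2 \in X by move: kX; case: (c1.2 \in X).
    by have := cP (exist _ c1.2 h); rewrite -appE.
  rewrite /thead (tnth_nth 0%N) /= /app.
  by case: pselect => h; [rewrite h|move/negP/negbTE: h => ->].
pose Xp p : bool := p \in X.
have computable_predX : computableb (fun c : ctx 1 => Xp c.2).
  exists cX => c1; have := cXP c1.2.
  by congr (recfun_eval cX _ _); apply: val_inj.
pose orb (i j : int) p := app (e1 *~ i + e2 *~ j)%R p.
have liftX p : Xp p -> exists x : X, val x = p by move=> h; exists (exist _ p h).
have orbX i j p : Xp p -> Xp (orb i j p).
  by case/liftX => x <-; rewrite /orb appE; exact: (valP (act _ x)).
have orb0 p : Xp p -> orb 0%R 0%R p = p.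
  by case/liftX => x <-; rewrite /orb appE !mulr0z addr0 act1.
have orbD i j i' j' p : Xp p -> orb i j (orb i' j' p) = orb (i + i')%R (j + j')%R p.
  case/liftX => x <-; rewrite /orb !appE -actM; congr (val (act _ x)).
  by rewrite !mulrzDr addrACA.
have orb_free i j p : Xp p -> orb i j p = p -> i = 0%R /\ j = 0%R.
  case/liftX => x <-; rewrite /orb appE => /val_inj E; apply: indep.
  by apply: contrapT => h; apply: (act_free _ x h).
have a1E p : Xp p -> app e1 p = orb 1%R 0%R p by rewrite /orb mulr1z mulr0z addr0.
have a2E p : Xp p -> app e2 p = orb 0%R 1%R p by rewrite /orb mulr1z mulr0z add0r.
pose lab := label Xp (app e1) (app e2).
pose decode d : flow_label := (inord (entW d), inord (entS d), entG d).
exists (fun x => decode (lab (val x))); split.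
  have okP := stage_okP orbX orb0 orbD orb_free a1E a2E.
  have [c cP] := label_program computable_predX (computable_app e1) (computable_app e2) okP
    (fun d => enum_rank (decode d) : nat).
  by exists c => x; apply: cP.
apply/flow_lcl_solution => // x.
have := label_flow orbX orb0 orbD orb_free a1E a2E (valP x : Xp (val x)).
rewrite !appE /flow_rule /= -/lab.
have bnd p : (entW (lab p) < 5)%N /\ (entS (lab p) < 5)%N by rewrite !ltnS; apply: ent_bounds.
have [h1 h2] := bnd (val x); have [h3 _] := bnd (val (act e1 x)).
have [_ h4] := bnd (val (act e2 x)).
by rewrite !inordK.
Qed.

End Computable.

Theorem theorem1p23 (R : realType) (n : nat) (hn : (2 <= n)%N) :
  exists P : LCL (Zpow n), COMPUTABLE P /\ ~ BAIRE R P.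
Proof.
pose i1 := Ordinal (ltnW hn : 0 < n)%N; pose i2 := Ordinal hn.
exists (@flow_lcl (Zpow n) (delta_mx 0 i1) (delta_mx 0 i2))%R; split.
  apply: flow_lcl_computable => i j; rewrite -!scaler_int => /rowP h.
  have := h i2; have := h i1; rewrite !mxE !eqxx /= !intz.
  by rewrite !mulr1 !mulr0 addr0 add0r.
exact: flow_lcl_not_baire.
Qed.
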